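(* Let $P_n$ be any convex polygon in the plane with $n$ sides $s_0,s_1,\ldots,s_{n-1}$, and for each $i$ let $D_i$ be the side disk of $P_n$ at $s_i$. Let $G$ be the intersection graph of $D_0,\ldots,D_{n-1}$, that is, the undirected graph with vertex set $\{D_0,D_1,\ldots,D_{n-1}\}$ in which two distinct disks $D_i,D_j$ are adjacent if and only if $D_i\cap D_j\neq\emptyset$. Then $G$ is a planar graph.
   Context: A convex polygon with $n$ sides ($n\ge 3$) is a bounded convex region with nonempty interior that is the intersection of $n$ closed halfplanes, each of whose boundary lines contains exactly one of the $n$ sides. For a side $s$ (a segment), the side disk at $s$ is the closed disk whose center is the midpoint of $s$ and whose diameter equals the length of $s$. *)

(* Defs.v *)
From HB Require Import structures.
From mathcomp Require Import all_boot all_order all_algebra.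
From mathcomp Require Import all_classical all_reals all_analysis.

Set Implicit Arguments.
Unset Strict Implicit.
Unset Printing Implicit Defensive.

Import Order.TTheory GRing.Theory Num.Theory.
Import numFieldNormedType.Exports.

Local Open Scope classical_set_scope.
Local Open Scope ring_scope.

(* [R^o] makes the product a normed module over R.  Its library norm is the max
   norm: it is used only for the topology and for boundedness, metric notions
   going through [edist]. *)
Notation plane R := (R^o * R^o)%type.

Section Plane.
Context {R : realType}.
Implicit Types (p q u v : plane R) (P : set (plane R)).

Definition edist p q : R :=
  Num.sqrt ((p.1 - q.1) ^+ 2 + (p.2 - q.2) ^+ 2).

Definition segment u v : set (plane R) :=
  [set p | exists2 t : R, 0 <= t <= 1 & p = (1 - t) *: u + t *: v].

(* The triple (a, b, c) stands for the halfplane a x + b y <= c; it is a genuine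
   halfplane, with boundary line a x + b y = c, when (a, b) <> (0, 0). *)
Definition proper_halfplane (h : R * R * R) : Prop := (h.1.1, h.1.2) <> (0, 0).

Definition halfplane (h : R * R * R) : set (plane R) :=
  [set p | h.1.1 * p.1 + h.1.2 * p.2 <= h.2].

Definition boundary_line (h : R * R * R) : set (plane R) :=
  [set p | h.1.1 * p.1 + h.1.2 * p.2 = h.2].

(* [s i] lists the two endpoints of the i-th side, in either order, and the
   numbering of the sides is arbitrary.  The last clause says that the line
   bounding the i-th halfplane contains the i-th side and no other side. *)
Definition convex_polygon n P (s : 'I_n -> plane R * plane R) : Prop :=
  [/\ bounded_set P,
      convex_set (P : set (convex_lmodType (plane R))),
      P° !=set0 &
      exists h : 'I_n -> R * R * R,
      [/\ forall i, proper_halfplane (h i),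
          P = \bigcap_i halfplane (h i),
          forall i, (s i).1 <> (s i).2 /\
            P `&` boundary_line (h i) = segment (s i).1 (s i).2 &
          forall i j,
            segment (s j).1 (s j).2 `<=` boundary_line (h i) <-> j = i]].

Definition midpoint u v : plane R := 2^-1 *: (u + v).

Definition side_disk (e : plane R * plane R) : set (plane R) :=
  [set p | edist p (midpoint e.1 e.2) <= edist e.1 e.2 / 2].

End Plane.

(* Undirected simple graph on a set of vertices. *)
Record graph (T : Type) := Graph {
  vertices : set T;
  adj : T -> T -> Prop;
  adj_vertices : forall x y, adj x y -> vertices x /\ vertices y;
  adj_sym : forall x y, adj x y -> adj y x;
  adj_irrefl : forall x, ~ adj x x
}.

Section IntersectionGraph.
Context {T : Type} (V : set (set T)).

Let iadj (A B : set T) : Prop :=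
  [/\ V A, V B, A <> B & A `&` B !=set0].

Let iadj_vertices A B : iadj A B -> V A /\ V B.
Proof. by case. Qed.

Let iadj_sym A B : iadj A B -> iadj B A.
Proof. by case=> VA VB AB I; split => //; [exact: nesym|rewrite setIC]. Qed.

Let iadj_irrefl A : ~ iadj A A.
Proof. by case. Qed.

Definition intersection_graph : graph (set T) :=
  Graph iadj_vertices iadj_sym iadj_irrefl.

End IntersectionGraph.

Section Planarity.
Context {R : realType}.

Definition simple_arc (a b : plane R) (A : set (plane R)) : Prop :=
  exists f : R -> plane R,
  [/\ {within `[0, 1], continuous f},
      {in `[0, 1]%classic &, injective f},
      f 0 = a, f 1 = b & A = f @` `[0, 1]].

(* A crossing-free drawing: vertices go to distinct points [pt x], each edge xy
   to a simple arc [arc x y] from [pt x] to [pt y] through no other vertex, and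
   the arcs of two distinct edges meet only at common endpoints. *)
Definition plane_drawing (T : Type) (G : graph T)
    (pt : T -> plane R) (arc : T -> T -> set (plane R)) : Prop :=
  [/\ forall x y, vertices G x -> vertices G y -> pt x = pt y -> x = y,
      forall x y, adj G x y ->
        simple_arc (pt x) (pt y) (arc x y) /\ arc x y = arc y x,
      forall x y z, adj G x y -> vertices G z -> arc x y (pt z) ->
        z = x \/ z = y &
      forall x y x' y', adj G x y -> adj G x' y' ->
        [set x; y] <> [set x'; y'] ->
        arc x y `&` arc x' y' `<=` pt @` ([set x; y] `&` [set x'; y'])].

Definition planar (T : Type) (G : graph T) : Prop :=
  exists pt arc, @plane_drawing T G pt arc.

End Planarity.

Arguments planar R {T} G.

(* Main.v *)
(* The disk with diameter [p, q] consists of the points seeing p and q at a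
   non-acute angle. Order the sides cyclically along the polygon and draw every
   pair of meeting disks as a chord between two sides; if the crossing relation
   between these chords is bipartite, the graph has a two-page drawing, the
   colour classes being drawn above and below a line.

   Replacing an arc of the boundary by its chord preserves the contacts between
   the sides of this arc and the other sides, so a bad pattern of contacts can be
   moved to a convex polygon with few vertices. Three pairwise crossing contacts
   would give a convex hexagon whose opposite side disks meet; this is excluded
   by looking at which sides the three contact points see at a non-acute angle.
   For a longer odd cycle of crossings, take the polygon and the cycle minimal
   and let 0 be a shortest side. Merging 0 with a neighbour gives a smaller odd
   cycle unless the cycle contains, between two chords at 0, the chord joining
   the two neighbours of 0. Then some convex pentagon ABCDE with AB no longer
   than BC and EA has contacts AB-CD, AB-DE and BC-EA, which is impossible. *)

Require Import Defs.
From HB Require Import structures.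
From mathcomp Require Import all_boot all_order all_algebra.
From mathcomp Require Import all_classical all_reals all_analysis.
From mathcomp Require Import ring lra zify.

Set Implicit Arguments.
Unset Strict Implicit.
Unset Printing Implicit Defensive.

Import Order.TTheory GRing.Theory Num.Theory.
Import numFieldNormedType.Exports.

Local Open Scope ring_scope.

(** * Contact inequalities in coordinates *)

Section Kite.
Variable R : realFieldType.

(** The contacts AB-CD, AB-DE, BC-EA do occur together in convex pentagons whose side AB is long.
    This is why the merging takes place at a shortest side, and why the two neighbours of that side
    must keep their lengths in the final pentagon. Minimality refers to the number of sides plus the
    length of the odd cycle, and the shortest side is chosen anew in each polygon. A coarser polygon
    is only a list of extreme points of one fixed convex set P, the original region, and contact
    points are only asked to lie in P. Thus coarsening never changes P and can be iterated. For the
    hexagon, a point that sees two opposite sides at a non-acute angle sees at most one further side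
    in this way. Comparing the powers of two contact points then removes all combinations but four.
    These are the images, under symmetries of the hexagon, of a single cyclic pattern, the pinwheel.
    The pinwheel and the pentagon are the two cases that resist angle counting; they are settled by
    inequalities in coordinates. *)

Lemma lt_sqr_ge0 (x y : R) : 0 <= x -> x < y -> x * x < y * y.
Proof. by move=> x0 xy; nra. Qed.

(* A = (d + c, s - k), B = (d - c, - s - k), C = (- L, 0) and E = (L, 0), with
   |AB| = 2: see [pentagon_unit], from whose hypotheses the fifth vertex D has
   been eliminated by [flat_contact]. *)
Lemma kite_core (d k c s L : R) :
  c * c + s * s = 1 -> 0 <= s -> s < k -> 0 < L ->
  d * d + (L + 1) * (k * k) <= (L + 1) * (L + 1) ->
  L * s < k * c + d * s ->
  4 <= (d + c - L) * (d + c - L) + (k - s) * (k - s) ->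
  (0 < c -> 4 * L * c * (L * L + 2 * L * c + 1) <=
     4 * L * c * (d * d + k * k) + (k * (L - c) - d * s) * (k * (L - c) - d * s)) ->
  False.
Proof.
move=> cs s0 sk L0 hE h4 h3 h1.
have k0 : 0 < k by lra.
have c1 : c <= 1 by nra.
have cn1 : -1 <= c by nra.
have kL : k * k <= L + 1.
  rewrite -(@ler_pM2l _ (L + 1)); last lra.
  have : 0 <= d * d by rewrite -expr2 sqr_ge0.
  lra.
have k20 : 0 < k * k by rewrite mulr_gt0.
have dlt : d < L + 1 - k * k / 2.
  rewrite ltNge; apply/negP => h.
  have h' : 0 < L + 1 - k * k / 2 by lra.
  have : (L + 1 - k * k / 2) * (L + 1 - k * k / 2) <= d * d by nra.
  have : 0 < (k * k) * (k * k) by rewrite mulr_gt0.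
  lra.
set eta := d + c - L in h3.
(* Up to sign, [eta] and [k - s] are the coordinates of A relative to E, so [h3] says that EA has
   length at least 2. When A is not to the left of E, the bound [dlt] makes EA shorter than 2. *)
have [e0|e0] := leP 0 eta.
  clear hE h4 h1 kL.
  have el : eta < 1 + c - k * k / 2 by rewrite /eta; lra.
  have e2 := lt_sqr_ge0 e0 el.
  have k2 : k * k <= 2 * (1 + c) by lra.
  have q4 : (k * k) * (k * k) <= (k * k) * (2 * (1 + c)) by rewrite ler_pM2l.
  have kc : k * (1 - c) <= 2 * s.
    rewrite leNgt; apply/negP => h.
    have h2 : (2 * s) * (2 * s) < (k * (1 - c)) * (k * (1 - c)).
      by apply: lt_sqr_ge0 => //; lra.
    have h5 : (k * k) * ((1 - c) * (1 - c)) <= (2 * (1 + c)) * ((1 - c) * (1 - c)).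
      by rewrite ler_wpM2r// -expr2 sqr_ge0.
    have h6 : 0 <= (1 + c) * (1 - c) * (1 + c).
      have c2 : 0 <= 1 + c by move: cn1; clear; lra.
      by rewrite !mulr_ge0// subr_ge0.
    have : s * s = (1 + c) * (1 - c) by lra.
    nra.
  have : k * (k * (1 - c)) <= k * (2 * s) by rewrite ler_pM2l.
  have : 0 <= k * s by rewrite mulr_ge0// ltW.
  lra.
set kap := k - s in h3.
have kap0 : 0 < kap by rewrite /kap; lra.
have h4' : - eta * s < kap * c by rewrite /eta /kap; lra.
have c0 : 0 < c.
  rewrite ltNge; apply/negP => h.
  have : 0 <= - eta * s by rewrite mulr_ge0//; lra.
  have : kap * c <= 0 by rewrite mulr_ge0_le0// ltW.
  lra.
have kap2 : 2 * s < kap.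
  have h5 : 0 <= - eta * s by rewrite mulr_ge0//; lra.
  have h6 := lt_sqr_ge0 h5 h4'.
  rewrite ltNge; apply/negP => h.
  have h7 : kap * kap <= (2 * s) * (2 * s) by nra.
  have : 0 <= s * s by rewrite mulr_ge0.
  move=> s2.
  have : 4 * (s * s) <= (eta * eta + kap * kap) * (s * s) by rewrite ler_wpM2r.
  have : (kap * kap) * (c * c + s * s) = kap * kap by rewrite cs mulr1.
  lra.
have k3 : 3 * s < k by move: kap2; rewrite /kap; clear; lra.
have {}h1 := h1 c0.
(* This decides the sign of the number squared in [h1]. If it is nonnegative, [h4] bounds it by
   [L * kap], and [hE] eliminates d. *)
have [hm|hm] := leP (k * c + d * s) (k * L).
  have h5 : (k * (L - c) - d * s) * (k * (L - c) - d * s) <= (L * kap) * (L * kap).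
    have h6 : 0 <= k * (L - c) - d * s by lra.
    have h7 : k * (L - c) - d * s < L * kap by rewrite /kap; lra.
    exact: ltW (lt_sqr_ge0 h6 h7).
  have h8 : 4 * c * (k * k) <= 8 * c * (1 - c) + kap * kap.
    rewrite -(ler_pM2l L0) -(ler_pM2l L0).
    have : 0 < 4 * L * c by rewrite !mulr_gt0.
    move=> lc.
    have : 4 * L * c * (d * d) <= 4 * L * c * ((L + 1) * (L + 1) - (L + 1) * (k * k)).
      by rewrite ler_pM2l//; lra.
    lra.
  (* For c at least 1/4, [h8] contradicts [3 * s < k]. For smaller c the side AB is steep: s is at
     least 9/10 and k exceeds 27/10, which is too much for [h4] and [h12]. *)
  have [c4|c4] := leP (1/4) c.
    have h9 : (3 * s) * (3 * s) <= k * k by nra.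
    have h9' : 9 * (s * s) <= k * k by move: h9; clear; lra.
    have h10 : s * (3 * s) <= s * k by rewrite ler_wpM2l// ltW.
    have h11 : (4 * c - 1) * (9 * (s * s)) <= (4 * c - 1) * (k * k).
      by apply: ler_wpM2l h9'; move: c4; clear; lra.
    have [c1'|c1'] := ltP c 1.
      have : 0 < (1 - c) * (36 * c * c + 24 * c - 4).
        by rewrite mulr_gt0 ?subr_gt0//; move: c4; clear; nra.
      have : s * s = (1 - c) * (1 + c) by lra.
      rewrite /kap in h8; nra.
    have cE : c = 1 by lra.
    have ss : s * s = 0 by rewrite cE in cs; lra.
    have sE : s = 0 by apply/eqP; move/eqP: ss; rewrite mulf_eq0 orbb.
    by rewrite /kap cE sE in h8; lra.
  have y0 : 0 < 1 + (L - d) by rewrite /eta in e0; lra.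
  have h12 : k * k <= 2 * (1 + (L - d)).
    rewrite -(@ler_pM2l _ (L + 1)); last lra.
    have : (1 + (L - d)) * (L + 1 + d) <= (1 + (L - d)) * (2 * L + 2).
      by rewrite ler_pM2l//; lra.
    lra.
  have h13 : s * (k * k) <= s * (2 * (1 + (L - d))) by rewrite ler_wpM2l.
  have s2 : 15/16 <= s * s by have := lt_sqr_ge0 (ltW c0) c4; move: cs; clear; lra.
  have s9 : 9/10 <= s.
    by rewrite leNgt; apply/negP => /(lt_sqr_ge0 s0); move: s2; clear; lra.
    have k27 : 27/10 < k by lra.
  have : 27/10 * (9/10 * k - 1/2) < k * (s * k - 2 * c).
    have h14 : 9/10 * k <= s * k by rewrite ler_pM2r.
    by apply: ltr_pM; move: k27 c4 h14; clear; lra.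
  lra.
have [Lc|Lc] := leP c L.
  have dl : d <= L - c by rewrite /eta in e0; lra.
  have : d * s <= (L - c) * s by rewrite ler_wpM2r.
  have : (L - c) * s <= (L - c) * k by rewrite ler_wpM2l ?subr_ge0// ltW.
  lra.
have d0 : d < 0 by rewrite /eta in e0; lra.
have h5 : eta * eta <= d * d.
  have := @lt_sqr_ge0 (- eta) (- d); rewrite !mulrNN => h.
  by apply/ltW/h; rewrite /eta in e0 *; lra.
have h6 : kap * kap <= k * k.
  have kk : kap <= k by rewrite /kap lerBlDr lerDl.
  by apply: ler_pM => //; exact: ltW.
have h7 : d * d <= (L + 1) * (L + 1).
  have : 0 < (L + 1) * (k * k) by rewrite mulr_gt0 ?addr_gt0.
  by move: hE; clear; lra.
have : (L + 1) * (d * d + k * k) <= (L + 1) * ((L + 1) * (L + 1)).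
  have : L * (d * d) <= L * ((L + 1) * (L + 1)) by rewrite ler_pM2l.
  lra.
rewrite ler_pM2l; last lra.
have : (L + 1) * (L + 1) < 2 * 2 by apply: lt_sqr_ge0; move: L0 Lc c1; clear; lra.
lra.
Qed.
End Kite.

Section PinwheelInequalities.
Variable R : realFieldType.

(* The configuration is that of [pinwheel_coord], in which A = (a1, a2),
   B = (- b1, b2), E = (e, 0), F = (f1, f2), b = (p1, p2) and c = (q1, - q2): the
   signs are chosen so that all the letters are nonnegative. *)
Lemma below_perp (Q H q2 n m y n0 : R) : 0 < Q -> 0 < H -> 0 <= y - q2 ->
  0 < q2 -> n * Q = - (m * H) + y * (Q * Q + H * H) -> m <= 0 -> n0 * Q = q2 * (Q * Q + H * H) -> n0 <= n.
Proof.
move=> Q0 H0 y0 q0 hn hm h0.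
have : 0 <= (n - n0) * Q by rewrite mulrBl hn h0; nra.
by rewrite pmulr_lge0// subr_ge0.
Qed.

(** Let X be the point where the perpendicular to cA at c meets the horizontal axis. E and F are not
    below the axis and are beyond this perpendicular, hence beyond the parallel to cA through X. As
    b sees EF at a non-acute angle, b is beyond that parallel too. The inequality of the arithmetic
    and geometric means then eliminates [q1]. *)
Lemma pinwheel_far (a1 a2 e f1 f2 p1 p2 q1 q2 : R) :
  a1 < q1 -> 0 < q2 -> 0 <= a2 -> 0 <= p2 -> 0 <= f2 ->
  (f2 + q2) * (a2 + q2) <= (f1 - q1) * (q1 - a1) ->
  q2 * (a2 + q2) <= (e - q1) * (q1 - a1) ->
  (e - p1) * (f1 - p1) + (0 - p2) * (f2 - p2) <= 0 ->
  4 * q2 * (a2 - p2 + q2) <= (p1 - a1) ^+ 2.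
Proof.
move=> aq q0 a0 p0 f0 hF hE hb.
set Q := q1 - a1; set H := a2 + q2.
have Q0 : 0 < Q by rewrite subr_gt0.
have H0 : 0 < H by rewrite /H; lra.
(* Up to the factor |cA|, [mm] and [nn] below are the coordinates along cA and across it, with
   origin c. The value of [nn] at X is [n0]. *)
set n0 := q2 * (Q * Q + H * H) / Q.
have n0Q : n0 * Q = q2 * (Q * Q + H * H) by rewrite /n0 divfK// gt_eqF.
pose nn x y := H * (x - q1) + Q * (y + q2).
pose mm x y := H * (y + q2) - Q * (x - q1).
have key x y : 0 <= y -> mm x y <= 0 -> n0 <= nn x y.
  move=> y0 m0; apply: (@below_perp Q H q2 _ (mm x y) (y + q2)) => //.
    by rewrite addrK.
  by rewrite /nn /mm; ring.
have nE : n0 <= nn e 0 by apply: key => //; rewrite /mm /Q /H; lra.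
have nF : n0 <= nn f1 f2 by apply: key => //; rewrite /mm /Q /H; lra.
have nb : n0 <= nn p1 p2.
  have [|mb] := leP (mm p1 p2) 0; first exact: key.
  have idt : (nn e 0 - nn p1 p2) * (nn f1 f2 - nn p1 p2) +
     (mm e 0 - mm p1 p2) * (mm f1 f2 - mm p1 p2) =
     (Q * Q + H * H) * ((e - p1) * (f1 - p1) + (0 - p2) * (f2 - p2)).
    by rewrite /nn /mm; ring.
  have mE : mm e 0 <= 0 by rewrite /mm /Q /H; lra.
  have mF : mm f1 f2 <= 0 by rewrite /mm /Q /H; lra.
  have r0 : (Q * Q + H * H) * ((e - p1) * (f1 - p1) + (0 - p2) * (f2 - p2)) <= 0.
    by rewrite mulr_ge0_le0// addr_ge0// mulr_ge0// ltW.
  rewrite leNgt; apply/negP => lt.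
  have : 0 < (nn e 0 - nn p1 p2) * (nn f1 f2 - nn p1 p2) by apply: mulr_gt0; lra.
  have : 0 <= (mm e 0 - mm p1 p2) * (mm f1 f2 - mm p1 p2) by apply: mulr_le0; lra.
  lra.
have hP : Q * Q * (H - p2) + q2 * (H * H) <= (p1 - a1) * H * Q.
  have : n0 * Q <= nn p1 p2 * Q by rewrite ler_pM2r.
  rewrite n0Q /nn /Q /H; lra.
clearbody nn mm n0; rewrite -/H in hP *.
have -> : a2 - p2 + q2 = H - p2 by rewrite /H; ring.
set P := p1 - a1 in hP *; clearbody Q H P.
have [m0|m0] := leP (H - p2) 0.
  apply: (@le_trans _ _ 0); last exact: sqr_ge0.
  by rewrite mulr_ge0_le0// mulr_ge0// ltW.
have HQ : 0 < H * Q by exact: mulr_gt0.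
have : (Q * Q * (H - p2) + q2 * (H * H)) ^+ 2 <= (P * H * Q) ^+ 2.
  have X0 : 0 <= Q * Q * (H - p2) + q2 * (H * H).
    by rewrite addr_ge0// !mulr_ge0// ltW.
  by apply: lerXn2r; rewrite ?nnegrE//; exact: le_trans hP.
have -> : P * H * Q = P * (H * Q) by ring.
rewrite (exprMn _ P) => h.
rewrite -(@ler_pM2r _ ((H * Q) ^+ 2)) ?exprn_gt0//.
apply: le_trans h.
have : 0 <= (Q * Q * (H - p2) - q2 * (H * H)) ^+ 2 by exact: sqr_ge0.
lra.
Qed.

(** Put P = p1 - a1 and x = a2 - p2. The angles at the origin and at b give P^2 < x (q2 - x), which
    is at most a quarter of q2^2, whereas [pinwheel_far] gives P^2 >= 4 q2 (x + q2) with x >= 0. *)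
Lemma pinwheel_final (a1 a2 b1 b2 e p1 p2 q2 : R) :
  0 < q2 -> 0 <= a1 -> 0 < a2 -> 0 <= p2 -> a1 < e ->
  a1 * p2 <= a2 * p1 -> a2 * (e - p1) <= p2 * (e - a1) ->
  4 * q2 * (a2 - p2 + q2) <= (p1 - a1) ^+ 2 ->
  a2 * b2 <= a1 * b1 ->
  0 < b1 + p1 ->
  p1 * (b1 + p1) < (b2 - p2) * (q2 + p2) ->
  (b2 - p2) * (p1 - a1) <= (a2 - p2) * (p1 + b1) ->
  False.
Proof.
move=> q0 a10 a20 p20 ae hang hcap hD hA u0 hB hC.
have P0 : 0 <= p1 - a1.
  rewrite leNgt; apply/negP => Pn.
  have h1 : a2 * (e - a1) < a2 * (e - p1) by rewrite ltr_pM2l//; lra.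
  have h2 : a2 < p2 by rewrite -(@ltr_pM2r _ (e - a1)) ?subr_gt0//; lra.
  have : a1 * a2 <= a1 * p2 by rewrite ler_wpM2l// ltW.
  have : a2 * p1 < a2 * a1 by rewrite ltr_pM2l//; lra.
  lra.
set P := p1 - a1 in P0 hD hC *; set x := a2 - p2 in hD hC *.
have p1E : p1 = P + a1 by rewrite /P; ring.
have T0 : 0 < q2 + p2 by lra.
have p1P : p1 * P <= x * (q2 + p2).
  rewrite -(ler_pM2r u0); nra.
have x0 : 0 <= x.
  rewrite leNgt; apply/negP => xn.
  have : 0 <= p1 * P by rewrite mulr_ge0// p1E; lra.
  have : x * (q2 + p2) < 0 by rewrite nmulr_rlt0.
  lra.
have Pp : 0 < P.
  rewrite lt_def P0 andbT; apply/eqP => PE.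
  by move: hD; rewrite PE expr0n/=; nra.
have p10 : 0 < p1 by lra.
have hTa : P * (q2 + p2) < p1 * (q2 + p2 - a2).
  rewrite ltNge; apply/negP => h.
  have : a2 * b2 * (q2 + p2) <= a1 * b1 * (q2 + p2) by rewrite ler_pM2r.
  have : a2 * (p1 * (b1 + p1)) < a2 * ((b2 - p2) * (q2 + p2)) by rewrite ltr_pM2l.
  have : (a1 * (q2 + p2) - a2 * p1) * (b1 + p1) <= 0.
    apply: mulr_le0_ge0; last exact: ltW.
    have : a1 * (q2 + p2) = p1 * (q2 + p2) - P * (q2 + p2) by rewrite /P; ring.
    lra.
  have : 0 <= a1 * p1 * (q2 + p2) by apply: mulr_ge0; [apply: mulr_ge0|]; lra.
  have : 0 <= a2 * p2 * (q2 + p2) by apply: mulr_ge0; [apply: mulr_ge0|]; lra.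
  lra.
have h1 : P * P * (q2 + p2) < x * (q2 - x) * (q2 + p2).
  have : P * (P * (q2 + p2)) < P * (p1 * (q2 + p2 - a2)) by rewrite ltr_pM2l.
  have : 0 <= q2 + p2 - a2.
    rewrite leNgt; apply/negP => h.
    have := pmulr_rlt0 (q2 + p2 - a2) p10; rewrite h => h'.
    have : 0 < P * (q2 + p2) by apply: mulr_gt0.
    lra.
  move=> h2; have : p1 * P * (q2 + p2 - a2) <= x * (q2 + p2) * (q2 + p2 - a2) by rewrite ler_wpM2r.
  rewrite /x; lra.
rewrite ltr_pM2r// in h1; move: hD; rewrite expr2 => hD.
nra.
Qed.
End PinwheelInequalities.

Section FlatContact.
Variable R : rcfType.

Lemma mulrr_ge0 (x : R) : 0 <= x * x.
Proof. by rewrite -expr2 sqr_ge0. Qed.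

Lemma cauchy_schwarz2 (a b c d x y : R) : 0 <= x -> 0 <= y ->
  a * a + b * b <= x * x -> c * c + d * d <= y * y -> a * c + b * d <= x * y.
Proof.
move=> x0 y0 h1 h2; rewrite leNgt; apply/negP => h.
have h3 : (x * y) * (x * y) < (a * c + b * d) * (a * c + b * d).
  by apply: lt_sqr_ge0 => //; rewrite mulr_ge0.
have h4 : (a * a + b * b) * (c * c + d * d) <= (x * x) * (y * y).
  by apply: ler_pM => //; rewrite addr_ge0// -expr2 sqr_ge0.
have : 0 <= (a * d - b * c) * (a * d - b * c) by rewrite -expr2 sqr_ge0.
lra.
Qed.

Lemma meeting_disks (x1 y1 x2 y2 u v r t : R) : 0 <= r -> 0 <= t ->
  (u - x1) * (u - x1) + (v - y1) * (v - y1) <= r * r ->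
  (u - x2) * (u - x2) + (v - y2) * (v - y2) <= t * t ->
  (x1 - x2) * (x1 - x2) + (y1 - y2) * (y1 - y2) <= (r + t) * (r + t).
Proof.
move=> r0 t0 h1 h2.
have := @cauchy_schwarz2 (x1 - u) (y1 - v) (u - x2) (v - y2) r t r0 t0.
have e1 : (x1 - u) * (x1 - u) + (y1 - v) * (y1 - v) <= r * r by lra.
move=> /(_ e1 h2); lra.
Qed.

(** If the unit disk about (d, -k) reaches the segment CE, the bound is direct. Otherwise both
    contact points are below CE. There the disks on CD and DE lie inside the disks whose diameters
    are the two parts of CE cut off by the foot (h, 0) of D. Eliminating h from the two distances
    between centres leaves an ellipse. *)
Lemma flat_contact (d k L h g x1 y1 x2 y2 : R) :
  0 < L -> 0 < g -> 0 < k ->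
  0 <= g * (d + L) + (h + L) * k -> 0 <= (L - h) * k - g * (d - L) ->
  (x1 - d) * (x1 - d) + (y1 + k) * (y1 + k) <= 1 ->
  (x2 - d) * (x2 - d) + (y2 + k) * (y2 + k) <= 1 ->
  (x1 + L) * (x1 - h) + y1 * (y1 - g) <= 0 ->
  (x2 - L) * (x2 - h) + y2 * (y2 - g) <= 0 ->
  0 <= g * (x1 + L) - (h + L) * y1 -> 0 <= (h - L) * y1 - g * (x1 - L) ->
  0 <= g * (x2 + L) - (h + L) * y2 -> 0 <= (h - L) * y2 - g * (x2 - L) ->
  d * d + (L + 1) * (k * k) <= (L + 1) * (L + 1).
Proof.
move=> L0 g0 k0 m1 m2 a1 a2 c1 c2 s11 s12 s21 s22.
have onaxis t : - L <= t -> t <= L -> (d - t) * (d - t) + k * k <= 1 ->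
    d * d + (L + 1) * (k * k) <= (L + 1) * (L + 1).
  clear -L0; move=> t1 t2 tk.
  have : (L + 1) * ((d - t) * (d - t) + k * k) <= (L + 1) * 1 by rewrite ler_pM2l//; lra.
  have tt : t * t <= L * L by nra.
  have hh : 0 <= L * ((d - t - 1) * (d - t - 1)) by rewrite mulr_ge0 ?mulrr_ge0 ?(ltW L0).
  have hh' : 0 <= L * ((d - t + 1) * (d - t + 1)) by rewrite mulr_ge0 ?mulrr_ge0 ?(ltW L0).
  have : d * d = (d - t) * (d - t) + 2 * t * (d - t) + t * t by ring.
  have [dt0|dt0] := leP 0 (d - t).
    have : t * (d - t) <= L * (d - t) by rewrite ler_wpM2r.
    lra.
  have : t * (d - t) <= - L * (d - t) by rewrite ler_wnM2r// ltW.
  lra.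
have cross x y : 0 <= y -> (x - d) * (x - d) + (y + k) * (y + k) <= 1 ->
    0 <= g * (x + L) - (h + L) * y -> 0 <= (h - L) * y - g * (x - L) ->
    d * d + (L + 1) * (k * k) <= (L + 1) * (L + 1).
  clear -onaxis g0 k0 m1 m2; move=> y0 a s1 s2.
  have yk : 0 < y + k by lra.
  pose t := (k * x + y * d) / (y + k).
  have tE : t * (y + k) = k * x + y * d by rewrite /t divfK// gt_eqF.
  apply: (onaxis t).
  - rewrite -(ler_pM2r yk) tE -(ler_pM2l g0).
    have : 0 <= k * (g * (x + L) - (h + L) * y) by rewrite mulr_ge0// ltW.
    have : 0 <= y * (g * (d + L) + (h + L) * k) by rewrite mulr_ge0.
    lra.
  - rewrite -(ler_pM2r yk) tE -(ler_pM2l g0).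
    have : 0 <= k * ((h - L) * y - g * (x - L)) by rewrite mulr_ge0// ltW.
    have : 0 <= y * ((L - h) * k - g * (d - L)) by rewrite mulr_ge0.
    lra.
  - have dE : (d - t) * (y + k) = k * (d - x) by rewrite mulrBl tE; ring.
    have yk2 : 0 < (y + k) * (y + k) by rewrite mulr_gt0.
    rewrite -(ler_pM2r yk2) mul1r.
    have -> : ((d - t) * (d - t) + k * k) * ((y + k) * (y + k)) =
       ((d - t) * (y + k)) * ((d - t) * (y + k)) + k * k * ((y + k) * (y + k)) by ring.
    rewrite dE.
    have : (k * k) * ((x - d) * (x - d) + (y + k) * (y + k)) <= (k * k) * 1.
      by rewrite ler_wpM2l// mulrr_ge0.
    have : k * k <= (y + k) * (y + k) by nra.
    lra.
have [y10|y10] := leP 0 y1; first exact: (cross x1 y1).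
have [y20|y20] := leP 0 y2; first exact: (cross x2 y2).
have yy1 : 0 < y1 * (y1 - g) by nra.
have yy2 : 0 < y2 * (y2 - g) by nra.
have [x1a x1b] : - L < x1 /\ x1 < h.
  have [xL|xL] := ltP (- L) x1; first by split=> //; rewrite ltNge; apply/negP => ?; nra.
  have xh : h < x1 by rewrite ltNge; apply/negP => ?; nra.
  have : 0 < (h + L) * y1 by nra.
  have : g * (x1 + L) <= 0 by nra.
  lra.
have [x2a x2b] : h < x2 /\ x2 < L.
  have [xL|xL] := ltP x2 L; first by split=> //; rewrite ltNge; apply/negP => ?; nra.
  have xh : x2 < h by rewrite ltNge; apply/negP => ?; nra.
  have : (h - L) * y2 < 0 by nra.
  have : 0 <= g * (x2 - L) by nra.
  lra.
have q1 : y1 * y1 <= y1 * (y1 - g) by nra.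
have q2 : y2 * y2 <= y2 * (y2 - g) by nra.
have f1 := @meeting_disks d (- k) ((h - L) / 2) 0 x1 y1 1 ((h + L) / 2).
have f2 := @meeting_disks d (- k) ((h + L) / 2) 0 x2 y2 1 ((L - h) / 2).
have {}f1 : d * d + k * k - 1 + d * L - L <= h * (L + 1 + d).
  have := f1 ler01 _ _ _; rewrite opprK subr0 mulr1 => f; have {}f := f _ a1 _.
  have := f; lra.
have {}f2 : d * d + k * k - 1 - d * L - L <= - h * (L + 1 - d).
  have := f2 ler01 _ _ _; rewrite opprK subr0 mulr1 => f; have {}f := f _ a2 _.
  have := f; lra.
have hL : - L < h /\ h < L by lra.
have d1 : d < L + 1.
  rewrite ltNge; apply/negP => dl.
  have : (L - h) * (L + 1 - d) <= 0 by nra.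
  have : 0 < k * k by rewrite mulr_gt0.
  have : 0 <= (d - L - 1) * (d - L + 1) by nra.
  lra.
have d2 : - (L + 1) < d.
  rewrite ltNge; apply/negP => dl.
  have : (h + L) * (L + 1 + d) <= 0 by nra.
  have : 0 < k * k by rewrite mulr_gt0.
  have : 0 <= (d + L - 1) * (d + L + 1) by nra.
  lra.
(* With the weights [L + 1 - d] and [L + 1 + d], the two right-hand sides cancel. *)
have g1 : (L + 1 - d) * (d * d + k * k - 1 + d * L - L) <= (L + 1 - d) * (h * (L + 1 + d)).
  by rewrite ler_wpM2l//; lra.
have g2 : (L + 1 + d) * (d * d + k * k - 1 - d * L - L) <= (L + 1 + d) * (- h * (L + 1 - d)).
  by rewrite ler_wpM2l//; lra.
lra.
Qed.
End FlatContact.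

(** * Disks with diameter [p, q] *)

Section Diameters.
Variable R : rcfType.
Implicit Types (p q r x y z A B C D E : R * R).

Definition det p q r : R :=
  (q.1 - p.1) * (r.2 - p.2) - (q.2 - p.2) * (r.1 - p.1).
(* By Thales, [dt z p q <= 0] says that z is in the disk with diameter [p, q]. *)
Definition dt z p q : R :=
  (p.1 - z.1) * (q.1 - z.1) + (p.2 - z.2) * (q.2 - z.2).
Definition sqd p q : R :=
  (p.1 - q.1) * (p.1 - q.1) + (p.2 - q.2) * (p.2 - q.2).

Lemma sqd_le0 p q : sqd p q <= 0 -> p = q.
Proof.
case: p q => [p1 p2] [q1 q2]; rewrite /sqd /= => h.
have h1 := mulrr_ge0 (p1 - q1); have h2 := mulrr_ge0 (p2 - q2).
by congr pair; apply/eqP; rewrite -subr_eq0 -[_ == 0]orbb -mulf_eq0; apply/eqP; lra.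
Qed.

Lemma det_ll p q : det p p q = 0.
Proof. by rewrite /det; ring. Qed.

(** The centres of the disks on BC and EA are at squared distance [S], so twice the root of [S] is
    at most |BC| + |EA|. Squaring twice removes the two lengths; what survives of their product is
    the square of the determinant [X]. *)
Lemma opposite_contact (d k c s L x y : R) :
  c * c + s * s = 1 -> 0 < L -> 0 < c ->
  (d - c - x) * (- L - x) + (- k - s - y) * (0 - y) <= 0 ->
  (L - x) * (d + c - x) + (0 - y) * (- k + s - y) <= 0 ->
  4 * L * c * (L * L + 2 * L * c + 1) <=
     4 * L * c * (d * d + k * k) + (k * (L - c) - d * s) * (k * (L - c) - d * s).
Proof.
move=> cs L0 c0 h1 h2.
set W := d * d + k * k.
set S := L * L + 2 * L * c + 1.
set Q := L * L - 2 * L * c + 1.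
have LC : 0 < 4 * L * c by rewrite !mulr_gt0.
set b2 := (d - c + L) * (d - c + L) + (k + s) * (k + s).
set e2 := (d + c - L) * (d + c - L) + (k - s) * (k - s).
have b20 : 0 <= b2 by rewrite addr_ge0 ?mulrr_ge0.
have e20 : 0 <= e2 by rewrite addr_ge0 ?mulrr_ge0.
set b := Num.sqrt b2; set e := Num.sqrt e2.
have bb : b * b = b2 by rewrite -expr2 sqr_sqrtr.
have ee : e * e = e2 by rewrite -expr2 sqr_sqrtr.
have b0 : 0 <= b by exact: sqrtr_ge0.
have e0 : 0 <= e by exact: sqrtr_ge0.
have := @meeting_disks R ((d - c - L) / 2) ((- k - s) / 2) ((d + c + L) / 2) ((- k + s) / 2)
   x y (b / 2) (e / 2) _ _ _ _.
have -> : b / 2 * (b / 2) = b2 / 4 by rewrite -bb; lra.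
have -> : e / 2 * (e / 2) = e2 / 4 by rewrite -ee; lra.
move=> /(_ _ _)H.
have {}H : 4 * S <= (b + e) * (b + e).
  have := H _ _ _ _; rewrite /S.
  have u1 : 0 <= b / 2 by lra.
  have u2 : 0 <= e / 2 by lra.
  move=> /(_ u1 u2) HH.
  have {}HH := HH _ _; rewrite /b2 /e2 in HH.
  have := HH; move=> /(_ _ _) HHH; move: cs => cs'.
  have t1 : (x - (d - c - L) / 2) * (x - (d - c - L) / 2) + (y - (- k - s) / 2) * (y - (- k - s) / 2) <=
    ((d - c + L) * (d - c + L) + (k + s) * (k + s)) / 4 by move: h1; clear; lra.
  have t2 : (x - (d + c + L) / 2) * (x - (d + c + L) / 2) + (y - (- k + s) / 2) * (y - (- k + s) / 2) <=
    ((d + c - L) * (d + c - L) + (k - s) * (k - s)) / 4 by move: h2; clear; lra.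
  by have := HHH t1 t2; move: cs'; clear; lra.
have sumE : b2 + e2 = 2 * W + 2 * Q by rewrite /b2 /e2 /W /Q; lra.
set X := k * (L - c) - d * s.
have X0 := mulrr_ge0 X.
have SQ : S - Q = 4 * L * c by rewrite /S /Q; ring.
have Y1 : 2 * S - W - Q <= b * e by lra.
have [Y0|Y0] := leP (2 * S - W - Q) 0.
  have : 4 * L * c * S <= 4 * L * c * W by rewrite ler_pM2l//; lra.
  lra.
have Y2 : (2 * S - W - Q) * (2 * S - W - Q) <= b2 * e2.
  rewrite -bb -ee.
  have : (2 * S - W - Q) * (2 * S - W - Q) <= (b * e) * (b * e) by apply: ler_pM => //; lra.
  lra.
have prodE : b2 * e2 = (W + Q) * (W + Q) - 4 * (d * (L - c) + k * s) * (d * (L - c) + k * s).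
  have -> : Q = (L - c) * (L - c) + s * s by rewrite /Q; lra.
  rewrite /b2 /e2 /W; ring.
have WQ : W * Q - (d * (L - c) + k * s) * (d * (L - c) + k * s) = X * X.
  have -> : Q = (L - c) * (L - c) + s * s by rewrite /Q; lra.
  rewrite /W /X; ring.
have QE : Q = S - 4 * L * c by lra.
rewrite prodE in Y2; clear -Y2 WQ QE; clearbody W X Q S; subst Q.
lra.
Qed.

Lemma pentagon_unit A B D z1 z2 z3 (L : R) :
  let C := (- L, 0) in let E := (L, 0) in
  0 < L -> sqd A B = 4 -> 4 <= sqd E A -> B.2 <= A.2 -> A.2 < 0 -> 0 < D.2 ->
  det C D A <= 0 -> det C D B <= 0 -> det D E A <= 0 -> det D E B <= 0 ->
  det E A B < 0 ->
  dt z1 A B <= 0 -> dt z1 C D <= 0 -> det C D z1 <= 0 -> det D E z1 <= 0 ->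
  dt z2 A B <= 0 -> dt z2 D E <= 0 -> det C D z2 <= 0 -> det D E z2 <= 0 ->
  dt z3 B C <= 0 -> dt z3 E A <= 0 -> False.
Proof.
case: A B D z1 z2 z3 => [a1 a2] [b1 b2] [h g] [x1 y1] [x2 y2] [x3 y3] /=.
rewrite /det /dt /sqd /= => L0 AB EA ba a20 g0 d1 d2 d3 d4 d5 z1 z1' z1l z1r z2 z2' z2l z2r z3 z3'.
(* The midpoint of AB is (d, -k), and (c, s) is half the vector from B to A, a unit vector because
   |AB| = 2. *)
pose d := (a1 + b1) / 2; pose k := - (a2 + b2) / 2.
pose c := (a1 - b1) / 2; pose s := (a2 - b2) / 2.
have a1E : a1 = d + c by rewrite /d /c; lra.
have a2E : a2 = - k + s by rewrite /k /s; lra.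
have b1E : b1 = d - c by rewrite /d /c; lra.
have b2E : b2 = - k - s by rewrite /k /s; lra.
clearbody d k c s; subst a1 a2 b1 b2.
have cs : c * c + s * s = 1 by lra.
have s0 : 0 <= s by lra.
apply: (@kite_core R d k c s L) => //.
- by move: a20; clear; lra.
- apply: (@flat_contact R d k L h g x1 y1 x2 y2) => //.
  + by move: a20 s0; clear; lra.
  + by move: d1 d2; clear; lra.
  + by move: d3 d4; clear; lra.
  + by move: z1 cs; clear; lra.
  + by move: z2 cs; clear; lra.
  + by move: z1'; clear; lra.
  + by move: z2'; clear; lra.
  + by move: z1l; clear; lra.
  + by move: z1r; clear; lra.
  + by move: z2l; clear; lra.
  + by move: z2r; clear; lra.
- by move: d5; clear; lra.
- by move: EA; clear; lra.
- by move=> c0; apply: (@opposite_contact d k c s L x3 y3) => //; lra.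
Qed.
End Diameters.

(** * Five sides *)

Section Pentagon.
Variable R : rcfType.
Implicit Types (p q r x y z A B C D E : R * R).

Definition touch p q x y := exists z, dt z p q <= 0 /\ dt z x y <= 0.

Definition between_mids (t : R) p q x y : R * R :=
  ((1 - t) * ((p.1 + q.1) / 2) + t * ((x.1 + y.1) / 2),
   (1 - t) * ((p.2 + q.2) / 2) + t * ((x.2 + y.2) / 2)).

(* Two meeting disks share a point of the segment joining their centres. *)
Lemma touch_mid p q x y : touch p q x y -> exists t, [/\ 0 <= t, t <= 1,
  dt (between_mids t p q x y) p q <= 0 & dt (between_mids t p q x y) x y <= 0].
Proof.
case: p q x y => [p1 p2] [q1 q2] [x1 x2] [y1 y2] [[z1 z2] []].
rewrite /between_mids /dt/= => h1 h2.
pose m1 := (p1 + q1) / 2; pose m2 := (p2 + q2) / 2.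
pose v1 := (x1 + y1) / 2 - m1; pose v2 := (x2 + y2) / 2 - m2.
pose r := ((p1 - q1) * (p1 - q1) + (p2 - q2) * (p2 - q2)) / 4.
pose r' := ((x1 - y1) * (x1 - y1) + (x2 - y2) * (x2 - y2)) / 4.
have E u w : (p1 - u) * (q1 - u) + (p2 - w) * (q2 - w) =
    (u - m1) * (u - m1) + (w - m2) * (w - m2) - r.
  by rewrite /m1 /m2 /r; field.
have E' u w : (x1 - u) * (y1 - u) + (x2 - w) * (y2 - w) =
    (u - m1 - v1) * (u - m1 - v1) + (w - m2 - v2) * (w - m2 - v2) - r'.
  by rewrite /v1 /v2 /m1 /m2 /r'; field.
rewrite E E' in h1 h2 *.
have r0 : 0 <= r by rewrite divr_ge0// addr_ge0 ?mulrr_ge0.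
have r0' : 0 <= r' by rewrite divr_ge0// addr_ge0 ?mulrr_ge0.
suff [t [t0 t1 k1 k2]] : exists t : R, [/\ 0 <= t, t <= 1,
   t * t * (v1 * v1 + v2 * v2) <= r & (1 - t) * (1 - t) * (v1 * v1 + v2 * v2) <= r'].
  exists t; split=> //; rewrite E || rewrite E'.
    by rewrite /v1 /v2 /m1 /m2 in k1 k2 *; lra.
  by rewrite /v1 /v2 /m1 /m2 in k1 k2 *; lra.
clearbody m1 m2 v1 v2 r r'; clear E E' p1 p2 q1 q2 x1 x2 y1 y2.
set a := z1 - m1 in h1 h2; set b := z2 - m2 in h1 h2.
clearbody a b; clear z1 z2 m1 m2.
set N := v1 * v1 + v2 * v2.
have N0 : 0 <= N by rewrite addr_ge0 ?mulrr_ge0.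
set s := a * v1 + b * v2.
have [s0|s0] := leP s 0.
  exists 0; split; rewrite ?ler01//; first lra.
  have := mulrr_ge0 a; have := mulrr_ge0 b; rewrite /N /s in s0 *; lra.
have [s1|s1] := leP N s.
  exists 1; split; rewrite ?ler01//; last lra.
  have := mulrr_ge0 (a - v1); have := mulrr_ge0 (b - v2); rewrite /N /s in s1 *; lra.
have Np : 0 < N by lra.
exists (s / N).
have sN : s / N * N = s by rewrite divfK// gt_eqF.
split; first by rewrite divr_ge0// ltW.
- by rewrite ler_pdivrMr// mul1r ltW.
- have -> : s / N * (s / N) * N = s * s / N by rewrite -mulrA sN mulrAC.
  rewrite ler_pdivrMr//.
  have : (a * a + b * b) * N <= r * N by rewrite ler_pM2r//; lra.
  have := mulrr_ge0 (a * v2 - b * v1); rewrite /s /N; lra.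
- have -> : (1 - s / N) * (1 - s / N) * N = (N - s) * (N - s) / N.
    by field; rewrite gt_eqF.
  rewrite ler_pdivrMr//.
  have : ((a - v1) * (a - v1) + (b - v2) * (b - v2)) * N <= r' * N by rewrite ler_pM2r//; lra.
  have := mulrr_ge0 (a * v2 - b * v1); rewrite /s /N; lra.
Qed.

Lemma det_between_mids a b (t : R) p q x y :
  det a b (between_mids t p q x y) =
  (1 - t) * ((det a b p + det a b q) / 2) + t * ((det a b x + det a b y) / 2).
Proof. by rewrite /det /between_mids/=; field. Qed.

Lemma det_l (a b : R * R) : det a b a = 0.
Proof. by rewrite /det; ring. Qed.

Lemma det_r (a b : R * R) : det a b b = 0.
Proof. by rewrite /det; ring. Qed.

Lemma touch_sym p q x y : touch p q x y -> touch x y p q.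
Proof. by case=> z [? ?]; exists z. Qed.

Lemma dtC z p q : dt z p q = dt z q p.
Proof. by rewrite /dt; ring. Qed.

Lemma touchC p q x y : touch p q x y -> touch q p x y.
Proof. by case=> z [? ?]; exists z; rewrite dtC. Qed.

Section Similarity.
Variables (o s : R) (O v : R * R).
Hypothesis (oo : o * o = 1) (s0 : s != 0).

(** The similarity that moves O to the origin and v to the positive horizontal direction; it
    reverses orientation for o = 1 and preserves it for o = -1. *)
Definition simil z : R * R :=
  ((v.1 * (z.1 - O.1) + v.2 * (z.2 - O.2)) / s,
   - o * (v.1 * (z.2 - O.2) - v.2 * (z.1 - O.1)) / s).

Let ratio := (v.1 * v.1 + v.2 * v.2) / (s * s).

Lemma dt_simil z p q : dt (simil z) (simil p) (simil q) = ratio * dt z p q.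
Proof.
rewrite /dt /simil /= /ratio.
transitivity (((v.1 * (p.1 - z.1) + v.2 * (p.2 - z.2)) * (v.1 * (q.1 - z.1) + v.2 * (q.2 - z.2))
  + (o * o) * ((v.1 * (p.2 - z.2) - v.2 * (p.1 - z.1)) * (v.1 * (q.2 - z.2) - v.2 * (q.1 - z.1)))) / (s * s)).
  by field.
by rewrite oo; field.
Qed.

Lemma sqd_simil p q : sqd (simil p) (simil q) = ratio * sqd p q.
Proof.
rewrite /sqd /simil /= /ratio.
transitivity (((v.1 * (p.1 - q.1) + v.2 * (p.2 - q.2)) * (v.1 * (p.1 - q.1) + v.2 * (p.2 - q.2))
  + (o * o) * ((v.1 * (p.2 - q.2) - v.2 * (p.1 - q.1)) * (v.1 * (p.2 - q.2) - v.2 * (p.1 - q.1)))) / (s * s)).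
  by field.
by rewrite oo; field.
Qed.

Lemma det_simil p q r : det (simil p) (simil q) (simil r) = - ratio * (o * det p q r).
Proof. by rewrite /det /simil /= /ratio; field. Qed.
End Similarity.

(** The endpoint A is the one nearer to CE. The sign o covers both orientations, so that the case
    where B is nearer follows by reading the pentagon backwards. A similarity reduces the claim to
    [pentagon_unit]. *)
Lemma pentagon_nearer (o : R) A B C D E : o * o = 1 ->
  0 < o * det C D E -> 0 < o * det C D A -> 0 < o * det C D B ->
  0 < o * det D E A -> 0 < o * det D E B -> 0 < o * det E A B ->
  0 < o * det C E A -> o * det C E A <= o * det C E B ->
  sqd A B <= sqd E A ->
  touch A B C D -> touch A B D E -> touch B C E A -> False.
Proof.
move=> oo CDE CDA CDB DEA DEB EAB CEA near AB t1 t2 [z3 [t3 t3']].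
have [t [ta0 ta1 z1 z1']] := touch_mid t1.
have [u [ua0 ua1 z2 z2']] := touch_mid t2.
have sl a b (w : R) p q x y : 0 <= w -> w <= 1 -> 0 <= o * det a b p -> 0 <= o * det a b q ->
    0 <= o * det a b x -> 0 <= o * det a b y -> 0 <= o * det a b (between_mids w p q x y).
  move=> w0 w1 h1 h2 h3 h4; rewrite det_between_mids.
  have : 0 <= (1 - w) * (o * det a b p + o * det a b q) by rewrite mulr_ge0//; lra.
  have : 0 <= w * (o * det a b x + o * det a b y) by rewrite mulr_ge0//; lra.
  lra.
pose O := ((C.1 + E.1) / 2, (C.2 + E.2) / 2).
pose v := (E.1 - C.1, E.2 - C.2).
pose N := v.1 * v.1 + v.2 * v.2.
have N0 : 0 < N.
  by rewrite ltNge; apply: contraTN CEA => /(@sqd_le0 _ E C) ->; rewrite det_ll mulr0 ltxx.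
have AB0 : 0 < sqd A B.
  by rewrite ltNge; apply: contraTN EAB => /sqd_le0 ->; rewrite det_r mulr0 ltxx.
have s20 : 0 < N * sqd A B / 4 by rewrite divr_gt0// mulr_gt0.
(* This scale gives the image of AB length 2. *)
pose s := Num.sqrt (N * sqd A B / 4).
have s0 : 0 < s by rewrite sqrtr_gt0.
have ss : s * s = N * sqd A B / 4 by rewrite -expr2 sqr_sqrtr// ltW.
have sN : s != 0 by rewrite gt_eqF.
pose T := simil o s O v.
pose k := (v.1 * v.1 + v.2 * v.2) / (s * s).
have k0 : 0 < k by rewrite divr_gt0// mulr_gt0.
have dtT z p q : dt z p q <= 0 -> dt (T z) (T p) (T q) <= 0.
  by move=> h; rewrite dt_simil// pmulr_rle0.
have detT p q r : 0 <= o * det p q r -> det (T p) (T q) (T r) <= 0.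
  by move=> h; rewrite det_simil// mulNr oppr_le0 mulr_ge0// ltW.
have TC : T C = (- (N / (2 * s)), 0).
  rewrite /T /simil /O /N /v /=; congr pair; field; rewrite ?sN//.
have TE : T E = (N / (2 * s), 0).
  rewrite /T /simil /O /N /v /=; congr pair; field; rewrite ?sN//.
have PinwheelCoordinates p : (T p).2 = - (o * det C E p) / s.
  rewrite /T /simil /O /v /det /=; field; rewrite ?sN//.
apply: (@pentagon_unit R (T A) (T B) (T D) (T (between_mids t A B C D))
  (T (between_mids u A B D E)) (T z3) (N / (2 * s))).
- by rewrite divr_gt0// mulr_gt0.
- rewrite sqd_simil// ss /N; field.
  by rewrite -/(sqd A B) -/N !gt_eqF.
- rewrite -TE !sqd_simil// -/k.
  have -> : 4 = k * sqd A B.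
    rewrite /k ss -/N; field.
    by rewrite !gt_eqF.
  by rewrite ler_pM2l.
- by rewrite !PinwheelCoordinates ler_pM2r ?invr_gt0// lerN2.
- by rewrite PinwheelCoordinates mulNr oppr_lt0 divr_gt0.
- rewrite PinwheelCoordinates mulNr oppr_gt0 pmulr_llt0 ?invr_gt0//.
  have -> : det C E D = - det C D E by rewrite /det; ring.
  by rewrite mulrN oppr_lt0.
- by rewrite -TC; apply/detT/ltW.
- by rewrite -TC; apply/detT/ltW.
- by rewrite -TE; apply/detT/ltW.
- by rewrite -TE; apply/detT/ltW.
- by rewrite -TE det_simil// mulNr oppr_lt0 mulr_gt0.
- exact: dtT.
- by rewrite -TC; exact: dtT.
- rewrite -TC; apply/detT/sl => //; rewrite ?det_l ?det_r ?mulr0 // ?ltW//.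
- rewrite -TE; apply/detT/sl => //; rewrite ?det_l ?det_r ?mulr0 // ?ltW//.
  have -> : det D E C = det C D E by rewrite /det; ring.
  exact: CDE.
- exact: dtT.
- by rewrite -TE; exact: dtT.
- rewrite -TC; apply/detT/sl => //; rewrite ?det_l ?det_r ?mulr0 // ?ltW//.
- rewrite -TE; apply/detT/sl => //; rewrite ?det_l ?det_r ?mulr0 // ?ltW//.
- by rewrite -TC; exact: dtT.
- by rewrite -TE; exact: dtT.
Qed.

(* Only the two neighbours of the side [A, B] have to be as long as it is. *)
Lemma pentagon A B C D E :
  0 < det C D E -> 0 < det C D A -> 0 < det C D B ->
  0 < det D E A -> 0 < det D E B -> 0 < det E A B -> 0 < det A B C ->
  0 < det C E A -> 0 < det C E B ->
  sqd A B <= sqd B C -> sqd A B <= sqd E A ->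
  touch A B C D -> touch A B D E -> touch B C E A -> False.
Proof.
move=> CDE CDA CDB DEA DEB EAB ABC CEA CEB BC EA t1 t2 t3.
have [h|h] := leP (det C E A) (det C E B).
  by apply: (@pentagon_nearer 1 A B C D E); rewrite ?mul1r.
(* Reading the pentagon as B, A, E, D, C exchanges A with B and C with E, and reverses the
   orientation. *)
have sw p q r : -1 * det p q r = det r q p by rewrite /det; ring.
apply: (@pentagon_nearer (-1) B A E D C); rewrite ?sw ?mulrNN ?mulr1//.
- by have -> : det B D E = det D E B by rewrite /det; ring.
- by have -> : det A D E = det D E A by rewrite /det; ring.
- by have -> : det B C D = det C D B by rewrite /det; ring.
- by have -> : det A C D = det C D A by rewrite /det; ring.
- by have -> : det B C E = det C E B by rewrite /det; ring.
- have -> : det B C E = det C E B by rewrite /det; ring.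
  have -> : det A C E = det C E A by rewrite /det; ring.
  exact: ltW.
- move: BC; rewrite /sqd; lra.
- by apply/touchC/touch_sym/touchC/touch_sym.
- by apply/touchC/touch_sym/touchC/touch_sym.
- by apply/touch_sym/touchC/touch_sym/touchC/touch_sym.
Qed.
End Pentagon.

(** * The pinwheel *)

Section PinwheelCoordinates.
Variable R : rcfType.
Implicit Types (p q r x y z a b c A B C D E F : R * R).

(** Seen from C, the points E, A, B turn counterclockwise within a half-turn, and z is between A and
    B; hence z also comes after E. A Plücker relation expresses this order. *)
Lemma fan_left C E A B z : 0 < det C E A -> 0 < det C A B -> 0 < det C E B ->
  0 < det C z B -> 0 <= det C A z -> 0 < det C E z.
Proof.
move=> h1 h2 h3 h4 h5; rewrite -(pmulr_lgt0 _ h2).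
have -> : det C E z * det C A B = det C E A * det C z B + det C E B * det C A z.
  by rewrite /det; ring.
by rewrite ltr_wpDr ?mulr_gt0 ?mulr_ge0// ltW.
Qed.

Lemma fan_right C E A B z : 0 < det C E A -> 0 < det C A B -> 0 < det C E B ->
  0 < det C E z -> 0 <= det C z A -> 0 < det C z B.
Proof.
move=> h1 h2 h3 h4 h5; rewrite -(pmulr_lgt0 _ h1).
have -> : det C z B * det C E A = det C E z * det C A B + det C z A * det C E B.
  by rewrite /det; ring.
by rewrite ltr_wpDr ?mulr_gt0 ?mulr_ge0// ltW.
Qed.

Lemma det_cyc p q r : det p q r = det q r p.
Proof. by rewrite /det; ring. Qed.

Lemma detN p q r : det p r q = - det p q r.
Proof. by rewrite /det; ring. Qed.

(** Two adjacent non-acute angles at z add up to at least a half-turn, so z is on the diagonal AC or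
    in the cap that AC cuts off with B. *)
Lemma half_turn A B C z : 0 < det z A B -> 0 < det z B C ->
  dt z A B <= 0 -> dt z B C <= 0 -> det z A C <= 0.
Proof.
move=> h1 h2 h3 h4.
have B0 : 0 < sqd B z.
  by rewrite ltNge; apply: contraTN h1 => /sqd_le0 ->; rewrite det_l ltxx.
rewrite -(pmulr_lle0 _ B0).
have -> : det z A C * sqd B z = det z A B * dt z B C + dt z A B * det z B C.
  by rewrite /det /dt /sqd; ring.
have : det z A B * dt z B C <= 0 by rewrite mulr_ge0_le0// ltW.
have : dt z A B * det z B C <= 0 by rewrite mulr_le0_ge0// ltW.
lra.
Qed.

(** The contact point a is the origin and E is on the positive horizontal axis. The angular order
    fixes the signs of the coordinates; the decisive comparisons are [a1 < q1] and [c2 < q2], which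
    put c to the right of A and below C. *)
Lemma pinwheel_coord (e : R) A B C D F b c :
  0 < e -> 0 < A.2 -> C.2 < 0 -> D.1 <= 0 -> D.2 < 0 -> 0 < F.2 ->
  let o := (0, 0) in let E := (e, 0) in
  0 < det o A B -> 0 < det o B C -> 0 < det o C D -> 0 < det o F A ->
  dt o A B <= 0 -> dt o B C <= 0 ->
  0 < b.2 -> 0 < det o b A -> det E A b <= 0 -> 0 < det A B b ->
  c.2 < 0 -> 0 < det D E c -> 0 < det E F c -> 0 < det E F A ->
  dt b B C <= 0 -> dt b E F <= 0 -> dt c C D <= 0 -> dt c F A <= 0 -> False.
Proof.
move=> e0; case: A B C D F b c => [a1 a2] [B1 b2] [C1 C2] [D1 D2] [f1 f2] [p1 p2] [q1 Q2].
rewrite /det /dt /= !subr0 => a20 C20 D10 D20 f20 AB BC CD FA dAB dBC p20 bA cap ABb Q20 DEc EFc EFA bBC bEF cCD cFA.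
have C10 : C1 < 0.
  rewrite ltNge; apply/negP => h.
  have : C1 * D2 <= 0 by rewrite mulr_ge0_le0// ltW.
  have : 0 <= C2 * D1 by rewrite mulr_le0// ltW.
  lra.
have b20 : 0 < b2.
  rewrite ltNge; apply/negP => h.
  have h1 : 0 <= b2 * C2 by rewrite mulr_le0// ltW.
  have B1p : 0 <= B1.
    rewrite leNgt; apply/negP => h2.
    have : 0 < B1 * C1 by rewrite nmulr_rgt0.
    lra.
  have : B1 * C2 <= 0 by rewrite mulr_ge0_le0// ltW.
  have : 0 <= b2 * C1 by rewrite mulr_le0// ltW.
  lra.
have ab2 : 0 < a2 * b2 by rewrite mulr_gt0.
have B10 : B1 < 0.
  rewrite ltNge; apply/negP => h.
  have a1n : a1 < 0.
    rewrite ltNge; apply/negP => h1.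
    have : 0 <= a1 * B1 by rewrite mulr_ge0.
    lra.
  have : a1 * b2 < 0 by rewrite nmulr_rlt0.
  have : 0 <= a2 * B1 by rewrite mulr_ge0// ltW.
  lra.
have a10 : 0 < a1.
  rewrite ltNge; apply/negP => h.
  have : 0 <= a1 * B1 by rewrite mulr_le0// ltW.
  lra.
have f10 : 0 < f1.
  rewrite ltNge; apply/negP => h.
  have : f1 * a2 <= 0 by rewrite mulr_le0_ge0// ltW.
  have : 0 < f2 * a1 by rewrite mulr_gt0.
  lra.
pose b1 := - B1; pose c1 := - C1; pose c2 := - C2; pose d1 := - D1; pose d2 := - D2; pose q2 := - Q2.
have B1E : B1 = - b1 by rewrite opprK.
have C1E : C1 = - c1 by rewrite opprK.
have C2E : C2 = - c2 by rewrite opprK.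
have D1E : D1 = - d1 by rewrite opprK.
have D2E : D2 = - d2 by rewrite opprK.
have Q2E : Q2 = - q2 by rewrite opprK.
clearbody b1 c1 c2 d1 d2 q2; subst B1 C1 C2 D1 D2 Q2.
rewrite !oppr_lt0 ?oppr_le0 in C20 D10 D20 Q20 C10 B10.
have [b10 c10 c20 d20 q20] := And5 B10 C10 C20 D20 Q20.
have qe : q1 < e.
  have : 0 < d2 * (e - q1).
    have : 0 < (e + d1) * q2 by rewrite mulr_gt0//; lra.
    lra.
  by rewrite pmulr_rgt0// subr_gt0.
have qd : q2 < d2.
  rewrite ltNge; apply/negP => h.
  have : (e + d1) * d2 <= (e + d1) * q2 by rewrite ler_pM2l//; lra.
  have : d2 * (e - q1) < d2 * (e + d1) \/ q1 <= - d1.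
    by have [h1|h1] := leP q1 (- d1); [right|left; rewrite ltr_pM2l//; lra].
  case=> h1; first lra.
  have q1n : q1 <= 0 by lra.
  have : 0 <= (a1 - q1) * (f1 - q1) by rewrite mulr_ge0 ?subr_ge0 ?(le_trans q1n) ?ltW.
  have : 0 < (f2 + q2) * (a2 + q2) by rewrite mulr_gt0 ?addr_gt0.
  lra.
have ha : (f2 + q2) * (a2 + q2) <= (f1 - q1) * (q1 - a1) by move: cFA; clear; lra.
have hap : 0 < (f2 + q2) * (a2 + q2) by rewrite mulr_gt0 ?addr_gt0.
have aq : a1 < q1.
  rewrite ltNge; apply/negP => h.
  have fq : f1 < q1.
    rewrite ltNge; apply/negP => h1.
    have : (f1 - q1) * (q1 - a1) <= 0 by rewrite mulr_ge0_le0 ?subr_ge0 ?subr_le0.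
    by rewrite leNgt (lt_le_trans hap ha).
  have h2 : 0 < f2 * (e - a1).
    have : 0 < a2 * (e - f1) by rewrite mulr_gt0 ?subr_gt0// (lt_trans fq).
    by move: EFA; clear; lra.
  have ae : a1 < e by rewrite pmulr_rgt0// subr_gt0 in h2.
  have h3 : a2 * (e - a1) < a2 * (e - f1) by rewrite ltr_pM2l// ltrD2l ltrN2 (lt_le_trans fq).
  have fa : a2 < f2 by rewrite -(@ltr_pM2r _ (e - a1)) ?subr_gt0//; move: h3 EFA; clear; lra.
  have : a2 * a1 < f2 * a1 by rewrite ltr_pM2r.
  have : f1 * a2 < a1 * a2 by rewrite ltr_pM2r// (lt_le_trans fq).
  by move: FA; clear; lra.
have cq : c2 < q2.
  have q10 := lt_trans a10 aq.
  have : 0 < (c1 + q1) * (d1 + q1) by apply: mulr_gt0; [exact: addr_gt0|exact: ltr_wpDl].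
  move=> h; have : 0 < (d2 - q2) * (q2 - c2) by move: h cCD; clear; lra.
  by rewrite pmulr_rgt0 ?subr_gt0.
have hE : q2 * (a2 + q2) <= (e - q1) * (q1 - a1).
  rewrite -(@ler_pM2l _ (f2 + q2)); last lra.
  have : (q1 - a1) * (q2 * (f1 - q1)) <= (q1 - a1) * ((e - q1) * (f2 + q2)).
    by rewrite ler_pM2l ?subr_gt0//; move: EFc; clear; lra.
  have : q2 * ((f2 + q2) * (a2 + q2)) <= q2 * ((f1 - q1) * (q1 - a1)) by rewrite ler_pM2l.
  lra.
have p10 : 0 < p1.
  rewrite ltNge; apply/negP => h.
  have : p1 * a2 <= 0 by rewrite mulr_le0_ge0// ltW.
  have : 0 < p2 * a1 by rewrite mulr_gt0.
  lra.
have hbB : (b1 + p1) * (c1 + p1) <= (b2 - p2) * (c2 + p2) by move: bBC; clear; lra.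
have hbBp : 0 < (b1 + p1) * (c1 + p1) by rewrite mulr_gt0 ?addr_gt0.
have bp : p2 < b2.
  have := lt_le_trans hbBp hbB.
  by rewrite pmulr_lgt0 ?subr_gt0 ?addr_gt0.
have far : 4 * q2 * (a2 - p2 + q2) <= (p1 - a1) ^+ 2.
  apply: (@pinwheel_far R a1 a2 e f1 f2 p1 p2 q1 q2) => //; try exact: ltW.
apply: (@pinwheel_final R a1 a2 b1 b2 e p1 p2 q2 q20 (ltW a10) a20 (ltW p20) (lt_trans aq qe) _ _ far).
- by move: bA; clear; lra.
- by move: cap; clear; lra.
- by move: dAB; clear; lra.
- exact: addr_gt0 b10 p10.
- apply: (@le_lt_trans _ _ ((b1 + p1) * (c1 + p1))).
    by rewrite mulrC ler_pM2l ?addr_gt0// lerDr ltW.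
  by apply: (le_lt_trans hbB); rewrite ltr_pM2l ?subr_gt0// ltrD2r.
- by move: ABb; clear; lra.
Qed.
End PinwheelCoordinates.

Ltac det_from h := have := h; rewrite /det; clear; lra.

Section Pinwheel.
Variable R : rcfType.
Implicit Types (p q r x y z a b c A B C D E F : R * R).

Definition inside_hexagon A B C D E F z :=
  [/\ 0 < det A B z, 0 < det B C z & 0 < det C D z] /\
  [/\ 0 < det D E z, 0 < det E F z & 0 < det F A z].

(** Shifting the sides by two permutes a, c, b cyclically, hence the name. By [half_turn] the three
    points lie in the caps cut off by AC, EA and CE, and this determines the angular order around a
    required by [pinwheel_coord]. *)
Lemma pinwheel A B C D E F a b c :
  0 < det A B C -> 0 < det A C E -> 0 < det A B E -> 0 < det B C E ->
  0 < det C D E -> 0 < det E F A ->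
  inside_hexagon A B C D E F a -> inside_hexagon A B C D E F b -> inside_hexagon A B C D E F c ->
  dt a A B <= 0 -> dt a B C <= 0 -> dt a D E <= 0 ->
  dt b B C <= 0 -> dt b E F <= 0 -> dt b F A <= 0 ->
  dt c C D <= 0 -> dt c D E <= 0 -> dt c F A <= 0 -> False.
Proof.
move=> ABC ACE ABE BCE CDE EFA [[ABa BCa CDa] [DEa EFa FAa]].
move=> [[ABb BCb CDb] [DEb EFb FAb]] [[ABc BCc CDc] [DEc EFc FAc]].
move=> aAB aBC aDE bBC bEF bFA cCD cDE cFA.
have half x y z w : 0 < det x y w -> 0 < det y z w -> dt w x y <= 0 -> dt w y z <= 0 ->
    det x z w <= 0.
  by rewrite -(det_cyc w x y) -(det_cyc w y z) -(det_cyc w x z); exact: half_turn.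
have aAC : det A C a <= 0 := half _ _ _ _ ABa BCa aAB aBC.
have bEA : det E A b <= 0 := half _ _ _ _ EFb FAb bEF bFA.
have cCE : det C E c <= 0 := half _ _ _ _ CDc DEc cCD cDE.
have AaE : 0 < det A a E.
  by apply: (@fan_right _ A B C E) => //; det_from aAC.
have CEa : 0 < det C E a.
  by apply: (@fan_left _ C E A B); [det_from ACE|det_from ABC|det_from BCE|det_from BCa|det_from aAC].
have Eac : 0 < det E a c.
  by apply: (@fan_left _ E a C D); [det_from CEa|det_from CDE|det_from DEa|det_from DEc|det_from cCE].
have Eba : 0 < det E b a.
  by apply: (@fan_right _ E F A a); [|det_from AaE|det_from EFa|det_from EFb|det_from bEA].
have Aab : 0 < det A a b.
  by apply: (@fan_left _ A a E F); [|det_from EFA|det_from FAa|det_from FAb|det_from bEA].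
pose v := (E.1 - a.1, E.2 - a.2).
pose T := simil (-1) 1 a v.
pose k := (v.1 * v.1 + v.2 * v.2) / (1 * 1).
have oo : -1 * -1 = 1 :> R by rewrite mulrNN mulr1.
have k0 : 0 < k.
  rewrite /k mulr1 divr1 ltNge; apply: contraTN EFa => /(@sqd_le0 _ E a) ->.
  by rewrite det_l ltxx.
have dtT z p q : dt z p q <= 0 -> dt (T z) (T p) (T q) <= 0.
  by move=> h; rewrite dt_simil ?oner_eq0// pmulr_rle0.
have detE p q r : det (T p) (T q) (T r) = k * det p q r.
  by rewrite det_simil ?oner_eq0// mulN1r mulrNN.
have detT p q r : 0 < det p q r -> 0 < det (T p) (T q) (T r).
  by move=> h; rewrite detE pmulr_rgt0.
have Ta : T a = (0, 0) by rewrite /T /simil !subrr !mulr0 subrr addr0 mulr0 mul0r.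
have TE : T E = (k, 0) by rewrite /T /simil /k /v /=; congr pair; field.
have PinwheelCoordinates p : (T p).2 = det a E p by rewrite /T /simil /v /det /=; field.
have T1 p : (T p).1 = dt a E p by rewrite /T /simil /v /dt /=; field.
apply: (@pinwheel_coord R k (T A) (T B) (T C) (T D) (T F) (T b) (T c)) => //.
all: rewrite ?T1 ?PinwheelCoordinates -?Ta -?TE.
- by det_from AaE.
- by det_from CEa.
- by rewrite /= dtC.
- by det_from DEa.
- by det_from EFa.
- by apply: detT; det_from ABa.
- by apply: detT; det_from BCa.
- by apply: detT; det_from CDa.
- by apply: detT; det_from FAa.
- exact: dtT.
- exact: dtT.
- by det_from Eba.
- by apply: detT; det_from Aab.
- by rewrite detE pmulr_rle0.
- exact: detT.
- by det_from Eac.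
- exact: detT.
- exact: detT.
- exact: detT.
- exact: dtT.
- exact: dtT.
- exact: dtT.
- exact: dtT.
Qed.
End Pinwheel.

(** * Six sides *)

Section SixSides.
Variable R : rcfType.
Implicit Types (p q r x y z a b c A B C D E F : R * R).

Lemma dt_between_mids (t : R) p q x y :
  let N := sqd ((p.1 + q.1) / 2, (p.2 + q.2) / 2) ((x.1 + y.1) / 2, (x.2 + y.2) / 2) in
  dt (between_mids t p q x y) p q = t * t * N - sqd p q / 4 /\
  dt (between_mids t p q x y) x y = (1 - t) * (1 - t) * N - sqd x y / 4.
Proof. by rewrite /dt /sqd /between_mids /=; split; field. Qed.

(** Strict bounds on t will put the contact point in the interior of the hexagon. A solution at an
    end of the range can be moved slightly, since both disks have positive radius. *)
Lemma touch_between_mids p q x y : 0 < sqd p q -> 0 < sqd x y -> touch p q x y ->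
  exists t, [/\ 0 < t, t < 1,
    dt (between_mids t p q x y) p q <= 0 & dt (between_mids t p q x y) x y <= 0].
Proof.
move=> pq xy /touch_mid[t [t0 t1]].
have [-> ->] := dt_between_mids t p q x y.
set N := sqd _ _ => h1 h2.
suff [s [s0 s1 k1 k2]] : exists s, [/\ 0 < s, s < 1, s * s * N <= sqd p q / 4 &
    (1 - s) * (1 - s) * N <= sqd x y / 4].
  exists s; have [E1 E2] := dt_between_mids s p q x y.
  by split; rewrite ?E1 ?E2 ?subr_le0.
have N0 : 0 <= N by rewrite addr_ge0 ?mulrr_ge0.
have small (e : R) : 0 < e -> exists s, [/\ 0 < s, s < 1, s * s * N <= e & (1 - s) * (1 - s) * N <= N].
  move=> e0; have d0 : 0 < N + e + 1 by lra.
  exists (e / (N + e + 1)); set s := e / _.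
  have s0 : 0 < s by rewrite divr_gt0.
  have s1 : s < 1 by rewrite ltr_pdivrMr// mul1r; lra.
  have sE : s * (N + e + 1) = e by rewrite divfK// gt_eqF.
  have se : 0 < s * e by rewrite mulr_gt0.
  have sN : s * N <= e by lra.
  split=> //.
    have : s * (s * N) <= 1 * (s * N) by apply: ler_wpM2r; [apply: mulr_ge0; lra|lra].
    lra.
  have : (1 - s) * (1 - s) <= 1 by nra.
  move=> h; have : (1 - s) * (1 - s) * N <= 1 * N by rewrite ler_wpM2r.
  lra.
move: t0; rewrite le_eqVlt => /orP[/eqP t0|t0].
  have [|s [s0 s1 k1 k2]] := small (sqd p q / 4); first by rewrite divr_gt0.
  by exists s; split=> //; rewrite -t0 in h2; lra.
move: t1; rewrite le_eqVlt => /orP[/eqP t1|t1].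
  have [|s [s0 s1 k1 k2]] := small (sqd x y / 4); first by rewrite divr_gt0.
  exists (1 - s); split; rewrite t1 in h1; lra.
by exists t; split=> //; lra.
Qed.

Definition mid p q : R * R := ((p.1 + q.1) / 2, (p.2 + q.2) / 2).

(* The difference of the powers of a and b is an affine function of the
   midpoint, so it cannot alternate in sign along a convex quadrilateral. *)
Lemma no_alternation a b p p' q q' r r' s s' :
  0 < det (mid p p') (mid q q') (mid r r') -> 0 < det (mid p p') (mid q q') (mid s s') ->
  0 < det (mid p p') (mid r r') (mid s s') -> 0 < det (mid q q') (mid r r') (mid s s') ->
  dt a p p' <= 0 -> 0 < dt b p p' -> dt a r r' <= 0 -> 0 < dt b r r' ->
  dt b q q' <= 0 -> 0 < dt a q q' -> dt b s s' <= 0 -> 0 < dt a s s' -> False.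
Proof.
set D4 := det _ _ (mid r r'); set D3 := det _ (mid q q') (mid s s').
set D2 := det (mid p p') (mid r r') _; set D1 := det (mid q q') _ _.
move=> d4 d3 d2 d1 ap bp ar br bq aq bs as'.
have E : D1 * (dt a p p' - dt b p p') + D3 * (dt a r r' - dt b r r') =
  D2 * (dt a q q' - dt b q q') + D4 * (dt a s s' - dt b s s').
  by rewrite /D1 /D2 /D3 /D4 /det /dt /mid /=; field.
have : D1 * (dt a p p' - dt b p p') < 0 by rewrite pmulr_rlt0//; lra.
have : D3 * (dt a r r' - dt b r r') < 0 by rewrite pmulr_rlt0//; lra.
have : 0 < D2 * (dt a q q' - dt b q q') by rewrite pmulr_rgt0//; lra.
have : 0 < D4 * (dt a s s' - dt b s s') by rewrite pmulr_rgt0//; lra.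
lra.
Qed.

Definition convex_chain n (V : nat -> R * R) :=
  forall i j k, (i < j)%N -> (j < k)%N -> (k < n)%N -> 0 < det (V i) (V j) (V k).

Definition rot6 (V : nat -> R * R) i := if i == 5%N then V 0%N else V i.+1.

Lemma convex_rot6 V : convex_chain 6 V -> convex_chain 6 (rot6 V).
Proof.
move=> H i j k ij jk k6; rewrite /rot6.
have j5 : (j < 5)%N by exact: leq_trans jk k6.
have i5 : (i < 5)%N by exact: ltn_trans ij j5.
rewrite (ltn_eqF i5) (ltn_eqF j5); case: eqP => [k5|/eqP k5].
  by rewrite -det_cyc; apply: H.
by apply: H => //; rewrite ltnS ltn_neqAle k5.
Qed.

(** The index 6 stands for vertex 0 again, so that side 5 needs no special form. *)
Definition hex_vertex (V : nat -> R * R) i := if i == 6%N then V 0%N else V i.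
Definition hex_mid V i := mid (hex_vertex V i) (hex_vertex V i.+1).

Lemma hex_vertex_ge0 V i j k : convex_chain 6 V -> (i <= j)%N -> (j <= k)%N -> (k <= 6)%N ->
  0 <= det (hex_vertex V i) (hex_vertex V j) (hex_vertex V k).
Proof.
move=> H; rewrite leq_eqVlt => /orP[/eqP-> _ _|ij].
  by rewrite det_ll.
rewrite leq_eqVlt => /orP[/eqP-> _|jk]; first by rewrite det_r.
rewrite /hex_vertex => k6.
have j6 : (j < 6)%N by exact: leq_trans jk _.
rewrite (ltn_eqF j6) (ltn_eqF (ltn_trans ij j6)).
case: eqP => [_|k6']; last by apply/ltW/H => //; rewrite ltn_neqAle k6 andbT; exact/eqP.
case: i ij => [_|i ij]; first by rewrite det_l.
by rewrite -det_cyc; apply/ltW/H.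
Qed.

(** As [det] is affine in each argument, its value at midpoints is the mean of eight values at
    vertices, all nonnegative and one positive. *)
Lemma hex_mid_gt0 V i j k : convex_chain 6 V -> (i < j)%N -> (j < k)%N -> (k < 6)%N ->
  0 < det (hex_mid V i) (hex_mid V j) (hex_mid V k).
Proof.
move=> H ij jk k6.
have ge := @hex_vertex_ge0 V.
have st : 0 < det (hex_vertex V i) (hex_vertex V j) (hex_vertex V k).
  rewrite /hex_vertex (ltn_eqF k6) (ltn_eqF (ltn_trans jk k6)).
  by rewrite (ltn_eqF (ltn_trans ij (ltn_trans jk k6))); exact: H.
have -> : det (hex_mid V i) (hex_mid V j) (hex_mid V k) =
  (det (hex_vertex V i) (hex_vertex V j) (hex_vertex V k) + det (hex_vertex V i) (hex_vertex V j) (hex_vertex V k.+1) +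
   det (hex_vertex V i) (hex_vertex V j.+1) (hex_vertex V k) + det (hex_vertex V i) (hex_vertex V j.+1) (hex_vertex V k.+1) +
   det (hex_vertex V i.+1) (hex_vertex V j) (hex_vertex V k) + det (hex_vertex V i.+1) (hex_vertex V j) (hex_vertex V k.+1) +
   det (hex_vertex V i.+1) (hex_vertex V j.+1) (hex_vertex V k) + det (hex_vertex V i.+1) (hex_vertex V j.+1) (hex_vertex V k.+1)) / 8.
  by rewrite /hex_mid /mid /det /=; field.
have ij' := ltnW ij; have jk' := ltnW jk; have k6' := ltnW k6.
have := ge i j k.+1 H ij' (leq_trans jk' (leqnSn k)) k6.
have := ge i j.+1 k H (leq_trans ij' (leqnSn j)) jk k6'.
have := ge i j.+1 k.+1 H (leq_trans ij' (leqnSn j)) (leq_trans jk (leqnSn k)) k6.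
have := ge i.+1 j k H ij jk' k6'.
have := ge i.+1 j k.+1 H ij (leq_trans jk' (leqnSn k)) k6.
have := ge i.+1 j.+1 k H (leq_trans ij (leqnSn j)) jk k6'.
have := ge i.+1 j.+1 k.+1 H (leq_trans ij (leqnSn j)) (leq_trans jk (leqnSn k)) k6.
move: st; clear; lra.
Qed.

Lemma cap_disjoint1 A C D E z : 0 < det C D E -> 0 < det C E A -> 0 < det C D A ->
  0 < det C D z -> det A C z <= 0 -> det C E z <= 0 -> False.
Proof.
move=> CDE CEA CDA CDz ACz CEz.
have E1 : det C D z * det C E A = - (det C D E * det C A z) + det C D A * det C E z.
  by rewrite /det; ring.
have : 0 < det C D z * det C E A by rewrite mulr_gt0.
have : 0 <= det C D E * det C A z by apply: mulr_ge0; [exact: ltW|det_from ACz].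
have : det C D A * det C E z <= 0 by rewrite mulr_ge0_le0// ltW.
lra.
Qed.

(** The diagonal AD separates the caps cut off by AC and by DF. *)
Lemma cap_disjoint2 A B C D F z : 0 < det A B C -> 0 < det A C D -> 0 < det A B D ->
  0 < det D F A -> 0 < det D A C -> 0 < det D F C ->
  0 < det A B z -> 0 < det C D z -> det A C z <= 0 -> det D F z <= 0 -> False.
Proof.
move=> ABC ACD ABD DFA DAC DFC ABz CDz ACz DFz.
have AzD : 0 < det A z D by apply: (@fan_right _ A B C D) => //; det_from ACz.
suff : 0 < det D F z by lra.
by apply: (@fan_left _ D F A C) => //; [det_from CDz|have := ltW AzD; rewrite /det; clear; lra].
Qed.

(** Seen from z, the points u, a, b, w follow each other within a half-turn, which has no room for
    two disjoint non-acute angles with a gap between them. *)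
Lemma two_gaps z u a b w : 0 < det z u a -> 0 < det z a b -> 0 < det z b w ->
  0 < det z u w -> 0 < det z u b -> 0 < det z a w ->
  dt z u a <= 0 -> dt z b w <= 0 -> False.
Proof.
move=> ua ab bw uw ub aw dua dbw.
have uu : 0 <= sqd u z by rewrite addr_ge0 ?mulrr_ge0.
have ww : 0 <= sqd w z by rewrite addr_ge0 ?mulrr_ge0.
pose g := - dt z u w.
have h1 : det z a w * sqd u z <= det z u a * g.
  have : dt z u a * det z u w <= 0 by rewrite mulr_le0_ge0// ltW.
  have -> : dt z u a * det z u w = det z a w * sqd u z - det z u a * g.
    by rewrite /g /dt /det /sqd; ring.
  lra.
have h2 : det z u b * sqd w z <= det z b w * g.
  have : dt z b w * det z u w <= 0 by rewrite mulr_le0_ge0// ltW.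
  have -> : dt z b w * det z u w = det z u b * sqd w z - det z b w * g.
    by rewrite /g /dt /det /sqd; ring.
  lra.
have h3 : (det z a w * sqd u z) * (det z u b * sqd w z) <= (det z u a * g) * (det z b w * g).
  by apply: ler_pM => //; rewrite mulr_ge0// ltW.
have h4 : det z u a * det z b w < det z a w * det z u b.
  have : 0 < det z u w * det z a b by rewrite mulr_gt0.
  have -> : det z u w * det z a b = det z a w * det z u b - det z u a * det z b w.
    by rewrite /det; ring.
  lra.
have h5 : sqd u z * sqd w z = g * g + det z u w * det z u w.
  by rewrite /g /dt /det /sqd; ring.
have uw2 : 0 < det z u w * det z u w by rewrite mulr_gt0.
have gg := mulrr_ge0 g.
have : (det z u a * det z b w) * (g * g) <= (det z a w * det z u b) * (g * g).
  by rewrite ler_wpM2r// ltW.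
have : (det z a w * det z u b) * (g * g) < (det z a w * det z u b) * (sqd u z * sqd w z).
  by rewrite ltr_pM2l ?mulr_gt0//; lra.
lra.
Qed.

(** From the cap cut off by FB, the vertices B, C, D, E appear within a half-turn, so [two_gaps]
    applies to BC and DE. *)
Lemma cap_opposite A B C D E F z :
  0 < det B E F -> 0 < det B F A -> 0 < det B E A -> 0 < det B D F -> 0 < det B D A ->
  0 < det E F B -> 0 < det E B C -> 0 < det E F C ->
  inside_hexagon A B C D E F z -> det F B z <= 0 -> dt z B C <= 0 -> dt z D E <= 0 -> False.
Proof.
move=> BEF BFA BEA BDF BDA EFB EBC EFC [[ABz BCz CDz] [DEz EFz FAz]] FBz dBC dDE.
have BEz : 0 < det B E z.
  by apply: (@fan_left _ B E F A) => //; [det_from ABz|det_from FBz].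
have BDz : 0 < det B D z.
  by apply: (@fan_left _ B D F A) => //; [det_from ABz|det_from FBz].
have EzC : 0 < det E z C.
  by apply: (@fan_right _ E F B C) => //; have := ltW BEz; rewrite /det; clear; lra.
apply: (@two_gaps z B C D E) => //.
- by det_from BCz.
- by det_from CDz.
- by det_from DEz.
- by det_from BEz.
- by det_from BDz.
- by det_from EzC.
Qed.
End SixSides.

Ltac chain_det H :=
  match goal with
  | |- is_true (0 < det (?V ?i) (?V ?j) (?V ?k)) =>
    first [exact (H i j k isT isT isT) | det_from (H j k i isT isT isT)
          | det_from (H k i j isT isT isT)]
  end.

Ltac chain_sign H := rewrite ?det_l ?det_r //;
  first [chain_det H | apply/ltW; chain_det H].

Section Hexagon.
Variable R : rcfType.
Implicit Types (p q r x y z a b c A B C D E F : R * R) (V : nat -> R * R).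

Definition reflect p : R * R := (- p.1, p.2).

Lemma pinwheel_mirror A B C D E F a b c :
  0 < det D E F -> 0 < det B D F -> 0 < det B E F -> 0 < det B D E ->
  0 < det B C D -> 0 < det F A B ->
  inside_hexagon A B C D E F a -> inside_hexagon A B C D E F b -> inside_hexagon A B C D E F c ->
  dt a A B <= 0 -> dt a D E <= 0 -> dt a F A <= 0 ->
  dt b B C <= 0 -> dt b D E <= 0 -> dt b E F <= 0 ->
  dt c B C <= 0 -> dt c C D <= 0 -> dt c F A <= 0 -> False.
Proof.
have dr p q r : det (reflect p) (reflect q) (reflect r) = det r q p.
  by rewrite /det /reflect /=; ring.
have tr z p q : dt (reflect z) (reflect p) (reflect q) = dt z q p.
  by rewrite /dt /reflect /=; ring.
have ir z : inside_hexagon A B C D E F z -> inside_hexagon (reflect F) (reflect E) (reflect D)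
    (reflect C) (reflect B) (reflect A) (reflect z).
  case=> [[h1 h2 h3] [h4 h5 h6]]; split; split; rewrite dr;
    [det_from h5|det_from h4|det_from h3|det_from h2|det_from h1|det_from h6].
move=> DEF BDF BEF BDE BCD FAB Ia Ib Ic a0 a3 a5 b1 b3 b4 c1 c2 c5.
by apply: (@pinwheel R (reflect F) (reflect E) (reflect D) (reflect C) (reflect B)
  (reflect A) (reflect b) (reflect a) (reflect c)); rewrite ?tr ?dr//; exact: ir.
Qed.

Definition in_hexagon V z := inside_hexagon (V 0%N) (V 1%N) (V 2%N) (V 3%N) (V 4%N) (V 5%N) z.
Definition sees V z i := dt z (hex_vertex V i) (hex_vertex V i.+1) <= 0.

Lemma half_cap A B C z : 0 < det A B z -> 0 < det B C z ->
  dt z A B <= 0 -> dt z B C <= 0 -> det A C z <= 0.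
Proof. by rewrite -(det_cyc z A B) -(det_cyc z B C) -(det_cyc z A C); exact: half_turn. Qed.

(** These are all six pairs among the sides 1, 2, 4, 5, so z sees at most one side besides 0 and 3.
    The first four pairs would put z in two disjoint caps; the pairs 1, 5 and 2, 4 fall under
    [cap_opposite]. *)
Lemma sees_two_opposite V z : convex_chain 6 V -> in_hexagon V z -> sees V z 0 -> sees V z 3 ->
  [/\ ~~ (sees V z 1 && sees V z 2), ~~ (sees V z 1 && sees V z 4),
      ~~ (sees V z 2 && sees V z 5) & ~~ (sees V z 4 && sees V z 5)] /\
  ~~ (sees V z 1 && sees V z 5) /\ ~~ (sees V z 2 && sees V z 4).
Proof.
move=> H I; have [[ABz BCz CDz] [DEz EFz FAz]] := I.
rewrite /sees /hex_vertex /= => s0 s3.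
split; [split|split]; apply/negP => /andP[s s'].
- apply: (@cap_disjoint1 R (V 0%N) (V 2%N) (V 3%N) (V 4%N) z); try chain_det H; try by [].
  + exact: half_cap ABz BCz s0 s.
  + exact: half_cap CDz DEz s' s3.
- apply: (@cap_disjoint2 R (V 0%N) (V 1%N) (V 2%N) (V 3%N) (V 5%N) z); try chain_det H; try by [].
  + exact: half_cap ABz BCz s0 s.
  + exact: half_cap DEz EFz s3 s'.
- apply: (@cap_disjoint2 R (V 5%N) (V 0%N) (V 1%N) (V 2%N) (V 4%N) z); try chain_det H; try by [].
  + exact: half_cap FAz ABz s' s0.
  + exact: half_cap CDz DEz s s3.
- apply: (@cap_disjoint1 R (V 3%N) (V 5%N) (V 0%N) (V 1%N) z); try chain_det H; try by [].
  + exact: half_cap DEz EFz s3 s.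
  + exact: half_cap FAz ABz s' s0.
- apply: (@cap_opposite R (V 0%N) (V 1%N) (V 2%N) (V 3%N) (V 4%N) (V 5%N) z); try chain_det H; try by [].
  exact: half_cap FAz ABz s' s0.
- apply: (@cap_opposite R (V 3%N) (V 4%N) (V 5%N) (V 0%N) (V 1%N) (V 2%N) z); try chain_det H; try by [].
  exact: half_cap CDz DEz s s3.
Qed.

Lemma sees_alternate V a b i j k l : convex_chain 6 V ->
  (i < j)%N -> (j < k)%N -> (k < l)%N -> (l < 6)%N ->
  sees V a i -> sees V a k -> sees V b j -> sees V b l ->
  ~~ sees V b i -> ~~ sees V b k -> ~~ sees V a j -> ~~ sees V a l -> False.
Proof.
rewrite /sees -!ltNge => H ij jk kl l6 ai ak bj bl bi bk aj al.
apply: (@no_alternation R a b (hex_vertex V i) (hex_vertex V i.+1) (hex_vertex V j) (hex_vertex V j.+1)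
  (hex_vertex V k) (hex_vertex V k.+1) (hex_vertex V l) (hex_vertex V l.+1)) => //; apply: hex_mid_gt0 => //.
- exact: ltn_trans kl l6.
- exact: ltn_trans jk kl.
- exact: ltn_trans ij jk.
Qed.

Lemma sees_alternate_bool V a b i j k l : convex_chain 6 V ->
  (i < j)%N -> (j < k)%N -> (k < l)%N -> (l < 6)%N ->
  ~~ [&& sees V a i, sees V a k, sees V b j, sees V b l, ~~ sees V b i,
         ~~ sees V b k, ~~ sees V a j & ~~ sees V a l].
Proof.
move=> H ij jk kl l6.
by apply/negP => /and5P[ai ak bj bl /and4P[bi bk aj al]]; exact: (sees_alternate H ij jk kl l6 ai ak bj bl).
Qed.

Lemma sqd_gt0 p q r : 0 < det p q r -> 0 < sqd p q.
Proof.
by move=> h; rewrite ltNge; apply: contraTN h => /sqd_le0 ->; rewrite det_ll ltxx.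
Qed.

Lemma in_hexagon_between V (t : R) : convex_chain 6 V -> 0 < t -> t < 1 ->
  in_hexagon V (between_mids t (V 0%N) (V 1%N) (V 3%N) (V 4%N)).
Proof.
move=> H t0 t1.
have pos1 p q x y (z w : R * R) : 0 <= det z w p -> 0 <= det z w q -> 0 <= det z w x -> 0 < det z w y ->
    0 < det z w (between_mids t p q x y).
  move=> hp hq hx hy; rewrite det_between_mids.
  have : 0 <= (1 - t) * (det z w p + det z w q) by apply: mulr_ge0; lra.
  have : 0 < t * (det z w x + det z w y) by apply: mulr_gt0; lra.
  lra.
have pos2 p q x y (z w : R * R) : 0 < det z w p -> 0 <= det z w q -> 0 <= det z w x -> 0 <= det z w y ->
    0 < det z w (between_mids t p q x y).
  move=> hp hq hx hy; rewrite det_between_mids.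
  have : 0 < (1 - t) * (det z w p + det z w q) by apply: mulr_gt0; lra.
  have : 0 <= t * (det z w x + det z w y) by apply: mulr_ge0; lra.
  lra.
split; split; first [by apply: pos1; chain_sign H | by apply: pos2; chain_sign H].
Qed.

Lemma opposite_in_hexagon V : convex_chain 6 V -> touch (V 0%N) (V 1%N) (V 3%N) (V 4%N) ->
  exists z, [/\ in_hexagon V z, sees V z 0 & sees V z 3].
Proof.
move=> H /touch_between_mids[||t [t0 t1 h1 h2]].
- by apply: (@sqd_gt0 _ _ (V 2%N)); chain_det H.
- by apply: (@sqd_gt0 _ _ (V 5%N)); chain_det H.
by exists (between_mids t (V 0%N) (V 1%N) (V 3%N) (V 4%N)); split => //; exact: in_hexagon_between.
Qed.

Lemma rot_in_hexagon V z : in_hexagon (rot6 V) z -> in_hexagon V z.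
Proof. by case=> [[? ? ?] [? ? ?]]; split; split. Qed.

Lemma in_hexagon_rot V z : in_hexagon V z -> in_hexagon (rot6 V) z.
Proof. by case=> [[? ? ?] [? ? ?]]; split; split. Qed.

Lemma hexagon V : convex_chain 6 V ->
  touch (V 0%N) (V 1%N) (V 3%N) (V 4%N) ->
  touch (V 1%N) (V 2%N) (V 4%N) (V 5%N) ->
  touch (V 2%N) (V 3%N) (V 5%N) (V 0%N) -> False.
Proof.
move=> H t1 t2 t3.
have H1 := convex_rot6 H; have H2 := convex_rot6 H1.
have [a [Ia a0 a3]] := opposite_in_hexagon H t1.
have [b [/rot_in_hexagon Ib b1 b4]] := @opposite_in_hexagon (rot6 V) H1 t2.
have [c [/rot_in_hexagon/rot_in_hexagon Ic c2 c5]] := @opposite_in_hexagon (rot6 (rot6 V)) H2 t3.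
have {}b1 : sees V b 1 := b1; have {}b4 : sees V b 4 := b4.
have {}c2 : sees V c 2 := c2; have {}c5 : sees V c 5 := c5.
have [[a12 a14 a25 a45] [a15 a24]] := sees_two_opposite H Ia a0 a3.
(* By conversion, side i of [rot6 V] is side i + 1 of V modulo 6, so the facts about b and c can be
   stated for V itself. *)
have [[b23 b25 b30 b50] [b20 b35]] :
    [/\ ~~ (sees V b 2 && sees V b 3), ~~ (sees V b 2 && sees V b 5),
        ~~ (sees V b 3 && sees V b 0) & ~~ (sees V b 5 && sees V b 0)] /\
    ~~ (sees V b 2 && sees V b 0) /\ ~~ (sees V b 3 && sees V b 5) :=
  sees_two_opposite H1 (in_hexagon_rot Ib) b1 b4.
have [[c34 c30 c41 c01] [c31 c40]] :
    [/\ ~~ (sees V c 3 && sees V c 4), ~~ (sees V c 3 && sees V c 0),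
        ~~ (sees V c 4 && sees V c 1) & ~~ (sees V c 0 && sees V c 1)] /\
    ~~ (sees V c 3 && sees V c 1) /\ ~~ (sees V c 4 && sees V c 0) :=
  sees_two_opposite H2 (in_hexagon_rot (in_hexagon_rot Ic)) c2 c5.
have P1 : ~~ [&& sees V a 1, sees V b 5 & sees V c 3].
  apply/negP => /and3P[a1 b5 c3].
  by apply: (@pinwheel R (V 0%N) (V 1%N) (V 2%N) (V 3%N) (V 4%N) (V 5%N) a b c) => //; chain_det H.
have P2 : ~~ [&& sees V a 4, sees V b 2 & sees V c 0].
  apply/negP => /and3P[a4 b2 c0].
  apply: (@pinwheel R (V 3%N) (V 4%N) (V 5%N) (V 0%N) (V 1%N) (V 2%N) a b c) => //; try chain_det H.
  - by case: Ia => [[? ? ?] [? ? ?]].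
  - by case: Ib => [[? ? ?] [? ? ?]].
  - by case: Ic => [[? ? ?] [? ? ?]].
have P3 : ~~ [&& sees V a 5, sees V b 3 & sees V c 1].
  apply/negP => /and3P[a5 b3 c1].
  by apply: (@pinwheel_mirror (V 0%N) (V 1%N) (V 2%N) (V 3%N) (V 4%N) (V 5%N) a b c) => //; chain_det H.
have P4 : ~~ [&& sees V a 2, sees V b 0 & sees V c 4].
  apply/negP => /and3P[a2 b0 c4].
  apply: (@pinwheel_mirror (V 3%N) (V 4%N) (V 5%N) (V 0%N) (V 1%N) (V 2%N) a b c) => //; try chain_det H.
  - by case: Ia => [[? ? ?] [? ? ?]].
  - by case: Ib => [[? ? ?] [? ? ?]].
  - by case: Ic => [[? ? ?] [? ? ?]].
(* Each of a, b, c has at most one extra side. The eleven alternations below exclude every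
   combination of these choices except the four pinwheels [P1] to [P4]. *)
have alt x y i j k l := @sees_alternate_bool V x y i j k l H.
have := alt a b 0%N 1%N 3%N 4%N isT isT isT isT.
have := alt b c 1%N 2%N 4%N 5%N isT isT isT isT.
have := alt a c 0%N 2%N 3%N 5%N isT isT isT isT.
have := alt a b 0%N 2%N 3%N 4%N isT isT isT isT.
have := alt c b 0%N 1%N 2%N 4%N isT isT isT isT.
have := alt a b 0%N 1%N 3%N 5%N isT isT isT isT.
have := alt b c 1%N 3%N 4%N 5%N isT isT isT isT.
have := alt a b 0%N 1%N 2%N 4%N isT isT isT isT.
have := alt a c 0%N 1%N 3%N 5%N isT isT isT isT.
have := alt b a 1%N 3%N 4%N 5%N isT isT isT isT.
have := alt a c 0%N 2%N 3%N 4%N isT isT isT isT.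
move: P1 P2 P3 P4; rewrite a0 a3 b1 b4 c2 c5 /=.
move: a12 a14 a25 a45 a15 a24; case: (sees V a 1); case: (sees V a 2); case: (sees V a 4);
  case: (sees V a 5) => //= _ _ _ _ _ _;
move: b23 b25 b30 b50 b20 b35; case: (sees V b 0); case: (sees V b 2); case: (sees V b 3);
  case: (sees V b 5) => //= _ _ _ _ _ _;
move: c34 c30 c41 c01 c31 c40; case: (sees V c 0); case: (sees V c 1); case: (sees V c 3);
  case: (sees V c 4) => //=.
Qed.
End Hexagon.

(** * Coarsening a polygon *)

Section Coarsening.
Variable R : rcfType.
Implicit Types (p q r x y z u w : R * R).

Definition comb (t : R) x y : R * R :=
  ((1 - t) * x.1 + t * y.1, (1 - t) * x.2 + t * y.2).

Variable P : R * R -> Prop.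
Hypothesis convP : forall x y (t : R), P x -> P y -> 0 <= t -> t <= 1 -> P (comb t x y).

Definition extreme u := P u /\
  forall x y (t : R), P x -> P y -> 0 < t -> t < 1 -> u = comb t x y -> x = y.

(* The common point is asked in P so that contacts survive [chord_of_arc]. *)
Definition touch_in p q x y := exists z, [/\ P z, dt z p q <= 0 & dt z x y <= 0].

Lemma comb0 x y : comb 0 x y = x.
Proof. by rewrite /comb subr0 !mul1r !mul0r !addr0; case: x. Qed.
Lemma comb1 x y : comb 1 x y = y.
Proof. by rewrite /comb subrr !mul1r !mul0r !add0r; case: y. Qed.

Lemma det_comb u w (t : R) x y : det u w (comb t x y) = (1 - t) * det u w x + t * det u w y.
Proof. by rewrite /det /comb /=; ring. Qed.

Lemma on_chord u w x : extreme u -> extreme w -> u <> w -> P x -> det u w x = 0 ->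
  exists t : R, [/\ 0 <= t, t <= 1 & x = comb t u w].
Proof.
move=> [Pu Eu] [Pw Ew] uw Px d0.
have N0 : 0 < sqd w u by rewrite ltNge; apply: contra_notN uw => /sqd_le0 ->.
pose t := dt u x w / sqd w u.
have tE : t * sqd w u = dt u x w by rewrite divfK// gt_eqF.
have xE : x = comb t u w.
  rewrite [LHS]surjective_pairing /comb; congr pair; apply/eqP; rewrite -subr_eq0;
    rewrite -(mulIr_eq0 _ (mulIf (lt0r_neq0 N0))).
    have -> : (x.1 - ((1 - t) * u.1 + t * w.1)) * sqd w u =
        (x.1 - u.1) * sqd w u - (t * sqd w u) * (w.1 - u.1) by ring.
    rewrite tE; apply/eqP.
    transitivity (- det u w x * (w.2 - u.2)); first by rewrite /dt /sqd /det; ring.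
    by rewrite d0; ring.
  have -> : (x.2 - ((1 - t) * u.2 + t * w.2)) * sqd w u =
      (x.2 - u.2) * sqd w u - (t * sqd w u) * (w.2 - u.2) by ring.
  rewrite tE; apply/eqP.
  transitivity (det u w x * (w.1 - u.1)); first by rewrite /dt /sqd /det; ring.
  by rewrite d0; ring.
exists t; split => //.
  rewrite leNgt; apply/negP => tn.
  have t1 : 0 < 1 - t by lra.
  have xw : x = w.
    apply: (Eu x w (- t / (1 - t)) Px Pw).
    - by rewrite divr_gt0// oppr_gt0.
    - by rewrite ltr_pdivrMr// mul1r; lra.
    - rewrite [LHS]surjective_pairing xE /comb /=; congr pair; field; rewrite gt_eqF//.
  have : t * sqd w u < 0 by rewrite nmulr_rlt0.
  by rewrite tE xw /dt -/(sqd w u) ltNge ltW.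
rewrite leNgt; apply/negP => tn.
have t0 : 0 < t by lra.
have xu : u = x.
  apply: (Ew u x (t^-1) Pu Px).
  - by rewrite invr_gt0.
  - by rewrite invf_lt1.
  - rewrite [LHS]surjective_pairing xE /comb /=; congr pair; field; rewrite gt_eqF//.
by move: tE; rewrite -xu /dt !subrr !mul0r addr0 => /eqP; rewrite mulf_eq0 !gt_eqF.
Qed.

Lemma cross_chord u w x y : extreme u -> extreme w -> u <> w -> P x -> P y ->
  det u w x <= 0 -> 0 <= det u w y ->
  exists s t : R, [/\ 0 <= s, s <= 1, 0 <= t, t <= 1 & comb s x y = comb t u w].
Proof.
move=> Eu Ew uw Px Py dx dy.
have [s [s0 s1 ds]] : exists s : R, [/\ 0 <= s, s <= 1 & det u w (comb s x y) = 0].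
  have [dx0|dx0] := eqVneq (det u w x) 0.
    by exists 0; rewrite comb0 lexx ler01.
  have dxn : det u w x < 0 by rewrite lt_def eq_sym dx0.
  have D : 0 < det u w y - det u w x by lra.
  exists (- det u w x / (det u w y - det u w x)); split.
  - by rewrite divr_ge0//; lra.
  - by rewrite ler_pdivrMr// mul1r; lra.
  - by rewrite det_comb; field; rewrite gt_eqF.
have [t [t0 t1 e]] := on_chord Eu Ew uw (convP Px Py s0 s1) ds.
by exists s, t.
Qed.

(** A diameter inside another one gives a disk inside the other. Up to the factor [N], [dt] is the
    product of the offsets of both ends from the foot of z, plus a squared distance to the line that
    is common to both segments. *)
Lemma dt_nested (a b : R) u w z : 0 <= a -> a <= 1 -> 0 <= b -> b <= 1 ->
  dt z (comb a u w) (comb b u w) <= 0 -> dt z u w <= 0.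
Proof.
have [wu|wu] := eqVneq u w.
  rewrite wu; have cw (c : R) : comb c w w = w.
    by rewrite [RHS]surjective_pairing /comb; congr pair; ring.
  by rewrite !cw.
wlog ab : a b / a <= b.
  move=> W a0 a1 b0 b1; have [ab|/ltW ba] := leP a b; first exact: W.
  by rewrite dtC; exact: W.
move=> a0 _ _ b1.
pose q := sqd u z; pose m := (u.1 - z.1) * (w.1 - u.1) + (u.2 - z.2) * (w.2 - u.2).
pose N := sqd w u.
have E1 : dt z (comb a u w) (comb b u w) = q + (a + b) * m + a * b * N.
  by rewrite /dt /comb /q /m /N /sqd /=; ring.
have E2 : dt z u w = q + m by rewrite /dt /q /m /sqd; ring.
have N0 : 0 <= N by rewrite addr_ge0 ?mulrr_ge0.
have h : 0 <= q * N - m * m.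
  have -> : q * N - m * m = det z u w * det z u w by rewrite /q /N /m /sqd /det; ring.
  exact: mulrr_ge0.
have q0 : 0 <= q by rewrite addr_ge0 ?mulrr_ge0.
rewrite E1 E2; clearbody q m N; clear E1 E2.
move=> f; rewrite leNgt; apply/negP => g.
have [Nz|Np] : N = 0 \/ 0 < N by move: N0; rewrite le_eqVlt => /orP[/eqP <-|]; [left|right].
  have mm : m * m = 0 by have := mulrr_ge0 m; rewrite Nz in h; lra.
  have m0 : m = 0 by apply/eqP; move/eqP: mm; rewrite mulf_eq0 orbb.
  by rewrite m0 Nz in f g; lra.
have f' : (m + a * N) * (m + b * N) + (q * N - m * m) <= 0.
  have : N * (q + (a + b) * m + a * b * N) <= 0 by rewrite mulr_ge0_le0.
  lra.
have g' : 0 < m * (m + N) + (q * N - m * m).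
  have : 0 < N * (q + m) by rewrite mulr_gt0.
  lra.
have aN : 0 <= a * N by rewrite mulr_ge0.
have bN : b * N <= N by rewrite -[leRHS]mul1r ler_pM2r.
have abN : a * N <= b * N by rewrite ler_pM2r.
have [k|k] := leP (m + a * N) 0.
  have [l|l] := leP 0 (m + b * N).
    have : (- (m + a * N)) * (m + b * N) <= (- m) * (m + N) by apply: ler_pM; lra.
    lra.
  have : 0 < (m + a * N) * (m + b * N) by rewrite nmulr_rgt0//; lra.
  lra.
have : 0 < (m + a * N) * (m + b * N) by rewrite mulr_gt0//; lra.
lra.
Qed.

(* Let z be the common point. If it is on the side of x, the rays from z to p0
   and p1 cross [u, w], so z sees u and w at a wider angle; otherwise move z
   towards x until it lies on [u, w]. *)
Lemma chord_of_arc u w p0 p1 x y : extreme u -> extreme w -> u <> w -> P p0 -> P p1 -> P x ->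
  det u w p0 <= 0 -> det u w p1 <= 0 -> 0 <= det u w x ->
  touch_in p0 p1 x y -> touch_in u w x y.
Proof.
move=> Eu Ew uw Pp0 Pp1 Px d0 d1 dx [z [Pz z1 z2]].
have [h|h] := leP 0 (det u w z).
  exists z; split=> //.
  have [s [t [s0 s1 t0 t1 e]]] := cross_chord Eu Ew uw Pp0 Pz d0 h.
  have [s' [t' [s'0 s'1 t'0 t'1 e']]] := cross_chord Eu Ew uw Pp1 Pz d1 h.
  apply: (dt_nested t0 t1 t'0 t'1); rewrite -e -e'.
  have -> : dt z (comb s p0 z) (comb s' p1 z) = (1 - s) * (1 - s') * dt z p0 p1.
    by rewrite /dt /comb /=; ring.
  by apply: mulr_ge0_le0 => //; apply: mulr_ge0; lra.
have [s [t [s0 s1 t0 t1 e]]] := cross_chord Eu Ew uw Pz Px (ltW h) dx.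
exists (comb s z x); split.
- exact: convP.
- rewrite e; have -> : dt (comb t u w) u w = - (t * (1 - t) * sqd u w).
    by rewrite /dt /comb /sqd /=; ring.
  rewrite oppr_le0; apply: mulr_ge0; last by rewrite addr_ge0 ?mulrr_ge0.
  by apply: mulr_ge0; lra.
- have -> : dt (comb s z x) x y = (1 - s) * (dt z x y - s * sqd x z).
    by rewrite /dt /comb /sqd /=; ring.
  have : 0 <= s * sqd x z by rewrite mulr_ge0// addr_ge0 ?mulrr_ge0.
  by move=> h2; apply: mulr_ge0_le0; lra.
Qed.

Lemma touch_in_touch p q x y : touch_in p q x y -> touch p q x y.
Proof. by case=> z [_ ? ?]; exists z. Qed.

Lemma touch_in_sym p q x y : touch_in p q x y -> touch_in x y p q.
Proof. by case=> z [? ? ?]; exists z. Qed.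
End Coarsening.

Definition nextv m i := if i.+1 == m then 0%N else i.+1.

(** Strict interlacing on the circle of sides: contacts that share a side do not cross. *)
Definition crossing (c d : nat * nat) : bool :=
  [|| [&& c.1 < d.1, d.1 < c.2 & c.2 < d.2] | [&& d.1 < c.1, c.1 < d.2 & d.2 < c.2]]%N.

Lemma crossingC c d : crossing c d = crossing d c.
Proof. by rewrite /crossing orbC. Qed.

Section Contacts.
Variable R : rcfType.
Variable P : R * R -> Prop.
Hypothesis convP : forall x y (t : R), P x -> P y -> 0 <= t -> t <= 1 -> P (comb t x y).
Implicit Types (V : nat -> R * R).

(** P need not be the hull of the vertices: an increasing sublist of them is again a polygon for the
    same P. *)
Definition polygon m V := convex_chain m V /\ forall i, (i < m)%N -> extreme P (V i).

Definition contact m V x y := touch_in P (V x) (V (nextv m x)) (V y) (V (nextv m y)).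

Lemma nextv_lt m i j : (i < j)%N -> (j < m)%N -> nextv m i = i.+1.
Proof. by move=> ij jm; rewrite /nextv ltn_eqF// (leq_trans _ jm). Qed.

Lemma chain_ge0 m V i j k : convex_chain m V -> (i <= j)%N -> (j <= k)%N -> (k < m)%N ->
  0 <= det (V i) (V j) (V k).
Proof.
move=> H; rewrite leq_eqVlt => /orP[/eqP-> _ _|ij].
  by rewrite det_ll.
rewrite leq_eqVlt => /orP[/eqP-> _|jk km]; first by rewrite det_r.
exact/ltW/H.
Qed.

Lemma chain_neq m V i j k : convex_chain m V -> (i < j)%N -> (j < m)%N ->
  (k < m)%N -> k != i -> k != j -> V i <> V j.
Proof.
move=> H ij jm km ki kj E.
have [ik|ik] := ltnP k i.
  by have := H _ _ _ ik ij jm; rewrite E det_r ltxx.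
have {}ik : (i < k)%N by rewrite ltn_neqAle eq_sym ki.
have [jk|jk] := ltnP k j.
  by have := H _ _ _ ik jk jm; rewrite E det_l ltxx.
have {}jk : (j < k)%N by rewrite ltn_neqAle eq_sym kj.
by have := H _ _ _ ij jk km; rewrite E det_ll ltxx.
Qed.

Lemma arc_merge m V a i b c y : polygon m V -> (2 < m)%N ->
  (a <= i)%N -> (i < b)%N -> (b < m)%N -> (c < m)%N -> (c <= a)%N || (b <= c)%N ->
  touch_in P (V i) (V i.+1) (V c) y -> touch_in P (V a) (V b) (V c) y.
Proof.
move=> [H E] m2 ai ib bm cm cab.
have ab : (a < b)%N by exact: leq_ltn_trans ib.
have im : (i < m)%N by exact: ltn_trans bm.
have am : (a < m)%N by exact: ltn_trans bm.
have EP j (jm : (j < m)%N) : P (V j) by case: (E j jm).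
apply: chord_of_arc => //; try exact: E; try exact: EP.
- have [k [km ka kb]] : exists k, [/\ (k < m)%N, k != a & k != b].
    case: (eqVneq a 0%N) => [a0|a0]; last first.
      by exists 0%N; split; [exact: leq_ltn_trans bm|rewrite eq_sym|rewrite ltn_eqF//; case: (b) ab].
    case: (eqVneq b 1%N) => [b1|b1].
      by exists 2%N; rewrite a0 b1.
    exists 1%N; rewrite a0; split=> //; first by exact: ltn_trans m2.
    by rewrite eq_sym.
  exact: chain_neq H ab bm km ka kb.
- by apply: EP; exact: leq_ltn_trans bm.
- by have := chain_ge0 H ai (ltnW ib) bm => h; det_from h.
- have := chain_ge0 H (leq_trans ai (leqnSn i)) ib bm => h; det_from h.
- case/orP: cab => h; first by have := chain_ge0 H h (ltnW ab) bm => h'; det_from h'.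
  exact: chain_ge0 H (ltnW ab) h cm.
Qed.

(** The counterpart of [arc_merge] for an arc from q to p that passes from the last vertex back to
    vertex 0; the side merged is the first of the arc. *)
Lemma wrap_merge m V p q c y : polygon m V -> (p < c)%N -> (c < q)%N -> (q < m)%N ->
  touch_in P (V q) (V (nextv m q)) (V c) y -> touch_in P (V q) (V p) (V c) y.
Proof.
move=> [H E] pc cq qm.
have pq : (p < q)%N by exact: ltn_trans cq.
have pm : (p < m)%N by exact: ltn_trans qm.
have cm : (c < m)%N by exact: ltn_trans qm.
have m0 : (0 < m)%N by exact: leq_ltn_trans qm.
have nm : (nextv m q < m)%N.
  by rewrite /nextv; case: eqP => // /eqP h; rewrite ltn_neqAle h.
have EP j (jm : (j < m)%N) : P (V j) by case: (E j jm).
apply: chord_of_arc => //; try exact: E; try exact: EP.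
- by move/esym; apply: (@chain_neq m V p q c) => //; [rewrite gtn_eqF|rewrite ltn_eqF].
- by rewrite det_l.
- rewrite /nextv; case: eqP => [_|/eqP h].
    have := chain_ge0 H (leq0n p) (ltnW pq) qm => h; det_from h.
  have qm' : (q.+1 < m)%N by rewrite ltn_neqAle h.
  by have := chain_ge0 H (ltnW pq) (leqnSn q) qm' => h'; det_from h'.
- by have := chain_ge0 H (ltnW pc) (ltnW cq) qm => h; det_from h.
Qed.

(** The six sides start at the vertices of a hexagon. Each side belongs to the arc over the hexagon
    side with the same start, so the contacts pass to the three pairs of opposite sides. *)
Lemma three_crossing_sorted m V p1 p2 p3 q1 q2 q3 : polygon m V ->
  (p1 < p2)%N -> (p2 < p3)%N -> (p3 < q1)%N -> (q1 < q2)%N -> (q2 < q3)%N -> (q3 < m)%N ->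
  contact m V p1 q1 -> contact m V p2 q2 -> contact m V p3 q3 -> False.
Proof.
move=> HP l1 l2 l3 l4 l5 l6.
have [H E] := HP.
have lt13 := ltn_trans l1 l2.
have l21 := ltn_trans l2 l3.
have l11 := ltn_trans lt13 l3.
have q2m := ltn_trans l5 l6.
have q1m := ltn_trans l4 q2m.
have p3m := ltn_trans l3 q1m.
have p2m := ltn_trans l2 p3m.
have p1m := ltn_trans l1 p2m.
have m2 : (2 < m)%N by apply: leq_trans p3m; rewrite ltnS (leq_trans _ l2)// ltnS (leq_trans _ l1).
rewrite /contact (nextv_lt l1)// (nextv_lt l4)// (nextv_lt l2)// (nextv_lt l5)// (nextv_lt l3)// => t1 t2 t3.
have step a b c d y : (a < b)%N -> (b < m)%N -> (c < m)%N -> (c <= a)%N || (b <= c)%N ->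
    y = V d -> touch_in P (V a) (V a.+1) (V c) y -> touch_in P (V a) (V b) (V c) y.
  by move=> ab bm cm cab _; apply: (@arc_merge m V a a b c y).
pose s := [:: p1; p2; p3; q1; q2; q3].
have ss : sorted ltn s by rewrite /= l1 l2 l3 l4 l5.
apply: (@hexagon R (fun i => V (nth 0%N s i))).
- move=> i j k ij jk k6.
  have j6 := ltn_trans jk k6; have i6 := ltn_trans ij j6.
  apply: H.
  + exact: (sorted_ltn_nth ltn_trans).
  + exact: (sorted_ltn_nth ltn_trans).
  + by move: k6; clear jk; do 6 (case: k => [|k] //=).
- apply: touch_in_touch; apply: touch_in_sym.
  apply: (@arc_merge m V q1 q1 q2 p1) => //=; first by rewrite (ltnW l11).
  apply: touch_in_sym.
  by apply: (@arc_merge m V p1 p1 p2 q1) => //=; rewrite (ltnW l21) orbT.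
- apply: touch_in_touch; apply: touch_in_sym.
  apply: (@arc_merge m V q2 q2 q3 p2) => //=; first by rewrite (ltnW (ltn_trans l21 l4)).
  apply: touch_in_sym.
  by apply: (@arc_merge m V p2 p2 p3 q2) => //=; rewrite (ltnW (ltn_trans l3 l4)) orbT.
- apply: touch_in_touch; apply: touch_in_sym.
  apply: (@wrap_merge m V p1 q3 p3) => //=; first exact: ltn_trans (ltn_trans l3 l4) l5.
  apply: touch_in_sym.
  by apply: (@arc_merge m V p3 p3 q1 q3) => //=; rewrite (ltnW (ltn_trans l4 l5)) orbT.
Qed.

Definition chord m V (c : nat * nat) := [/\ (c.1 < c.2)%N, (c.2 < m)%N & contact m V c.1 c.2].

Lemma three_crossing m V c d e : polygon m V -> chord m V c -> chord m V d -> chord m V e ->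
  crossing c d -> crossing d e -> crossing c e -> False.
Proof.
move=> HP.
have W (x y z : nat * nat) : (x.1 < y.1)%N -> (y.1 < z.1)%N ->
    chord m V x -> chord m V y -> chord m V z ->
    crossing x y -> crossing y z -> crossing x z -> False.
  move=> cd de [c12 cm Cc] [d12 dm Cd] [e12 em Ce].
  have ce := ltn_trans cd de.
  rewrite /crossing (ltnNge y.1 x.1) (ltnW cd) (ltnNge z.1 y.1) (ltnW de) (ltnNge z.1 x.1) (ltnW ce).
  rewrite /= !orbF => /and3P[_ h1 h2] /and3P[_ h3 h4] /and3P[_ h5 h6].
  exact: (@three_crossing_sorted m V x.1 y.1 z.1 x.2 y.2 z.2).
move=> Cc Cd Ce cd de ce.
have neq (x y : nat * nat) : crossing x y -> x.1 <> y.1.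
  by rewrite /crossing => h E; move: h; rewrite E ltnn.
have dc : crossing d c by rewrite crossingC.
have ed : crossing e d by rewrite crossingC.
have ec : crossing e c by rewrite crossingC.
case: (ltngtP c.1 d.1) => [h1|h1|/(neq _ _ cd)//];
case: (ltngtP d.1 e.1) => [h2|h2|/(neq _ _ de)//];
case: (ltngtP c.1 e.1) => [h3|h3|/(neq _ _ ce)//].
- exact: (W c d e).
- by have := ltn_trans h1 h2; rewrite ltnNge (ltnW h3).
- exact: (W c e d).
- exact: (W e c d).
- exact: (W d c e).
- exact: (W d e c).
- by have := ltn_trans h2 h1; rewrite ltnNge (ltnW h3).
- exact: (W e d c).
Qed.

(** The pentagon has the vertices 0, 1, 2, b' and m - 1. Sides b and b' are absorbed by the arcs
    from 2 to b' and from b' to m - 1, whereas the sides 0, 1 and m - 1 are kept, so their lengths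
    can still be compared. *)
Lemma smallest_side m V b b' : polygon m V -> (1 < b)%N -> (b < b')%N -> (b'.+1 < m)%N ->
  sqd (V 0%N) (V 1%N) <= sqd (V 1%N) (V 2%N) ->
  sqd (V 0%N) (V 1%N) <= sqd (V m.-1) (V 0%N) ->
  contact m V 0 b -> contact m V 0 b' -> contact m V 1 m.-1 -> False.
Proof.
move=> HP b1 bb b'm s1 s2; have [H E] := HP.
have b2 : (2 < b')%N by exact: leq_trans bb.
have m3 : (3 < m)%N by apply: leq_trans b'm; rewrite !ltnS ltnW.
have bm1 : (b' < m.-1)%N by rewrite -ltnS prednK// (leq_trans _ m3).
have mm : (m.-1 < m)%N by rewrite prednK// (leq_trans _ m3).
have nm : nextv m m.-1 = 0%N by rewrite /nextv prednK ?eqxx// (leq_trans _ m3).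
rewrite /contact nm.
have n0 : nextv m 0 = 1%N by apply: (@nextv_lt m 0 1) => //; exact: leq_trans m3.
have n1 : nextv m 1 = 2%N by apply: (@nextv_lt m 1 2) => //; exact: leq_trans m3.
have nb : nextv m b = b.+1 by apply: nextv_lt bb _; exact: ltn_trans mm.
have nb' : nextv m b' = b'.+1 by apply: nextv_lt bm1 mm.
rewrite n0 n1 nb nb' => t1 t2 t3.
have m2 : (2 < m)%N by exact: leq_trans m3.
have b'm' : (b' < m)%N by exact: ltn_trans mm.
have m0 : (0 < m)%N by exact: leq_trans m2.
have two : (2 < m.-1)%N by exact: ltn_trans bm1.
apply: (@pentagon R (V 0%N) (V 1%N) (V 2%N) (V b') (V m.-1)) => //.
- exact: H.
- by have h : 0 < det (V 0%N) (V 2%N) (V b') by [exact: H]; det_from h.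
- by have h : 0 < det (V 1%N) (V 2%N) (V b') by [exact: H]; det_from h.
- by have h : 0 < det (V 0%N) (V b') (V m.-1) by [apply: H => //; exact: ltn_trans b2]; det_from h.
- by have h : 0 < det (V 1%N) (V b') (V m.-1) by [apply: H => //; exact: ltn_trans b2]; det_from h.
- by have h : 0 < det (V 0%N) (V 1%N) (V m.-1) by [apply: H => //; exact: ltn_trans two]; det_from h.
- exact: H.
- by have h : 0 < det (V 0%N) (V 2%N) (V m.-1) by [exact: H]; det_from h.
- by have h : 0 < det (V 1%N) (V 2%N) (V m.-1) by [exact: H]; det_from h.
- apply: touch_in_touch; apply: touch_in_sym.
  by apply: (@arc_merge m V 2 b b' 0) => //; exact: touch_in_sym t1.
- apply: touch_in_touch; apply: touch_in_sym.
  by apply: (@arc_merge m V b' b' m.-1 0) => //; exact: touch_in_sym t2.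
- exact: touch_in_touch t3.
Qed.
End Contacts.

(** * Crossing contacts *)

Section Walks.
Variable R : rcfType.
Variable P : R * R -> Prop.
Hypothesis convP : forall x y (t : R), P x -> P y -> 0 <= t -> t <= 1 -> P (comb t x y).
Implicit Types (V : nat -> R * R) (c : nat -> nat * nat).

(** A closed walk of length k is a k-periodic sequence, possibly with repetitions; this spares
    modular indices. *)
Definition walk m V k c := [/\ forall t, c (t + k)%N = c t,
  forall t, chord P m V (c t) & forall t, crossing (c t) (c t.+1)].

(** Side i becomes side i + 1, cyclically. When the second end of a chord becomes 0, [rot_ends]
    swaps the ends to keep them increasing. *)
Definition rot_vertices m V i := if i == 0%N then V m.-1 else V i.-1.
Definition rot_ends m (d : nat * nat) := if d.2.+1 == m then (0%N, d.1.+1) else (d.1.+1, d.2.+1).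

Lemma rot_vertices_nextv m V i : (i < m)%N -> rot_vertices m V (nextv m i) = V i.
Proof. by rewrite /rot_vertices /nextv => im; case: (i.+1 =P m) => // <-. Qed.

Lemma nextv_ltn m i : (i < m)%N -> (nextv m i < m)%N.
Proof. by rewrite /nextv; case: eqP => //; lia. Qed.

Lemma rot_polygon m V : (0 < m)%N -> polygon P m V -> polygon P m (rot_vertices m V).
Proof.
move=> m0 [H E]; split=> [i j k ij jk km|i im]; last first.
  by rewrite /rot_vertices; case: eqP => _; apply: E; lia.
rewrite /rot_vertices (gtn_eqF (leq_ltn_trans (leq0n i) ij)).
rewrite (gtn_eqF (leq_ltn_trans (leq0n j) jk)).
case: eqP => [i0|i0]; last by apply: H; lia.
by rewrite det_cyc; apply: H; lia.
Qed.

Lemma rot_chord m V d : chord P m V d -> chord P m (rot_vertices m V) (rot_ends m d).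
Proof.
case: d => [x y] [/= xy ym C]; have xm := ltn_trans xy ym.
have K i : (i < m)%N -> rot_vertices m V (nextv m (nextv m i)) = V (nextv m i).
  by move=> im; rewrite rot_vertices_nextv// nextv_ltn.
have C' : contact P m (rot_vertices m V) (nextv m x) (nextv m y).
  by rewrite /contact !rot_vertices_nextv// ?nextv_ltn.
have nxx : nextv m x = x.+1 by apply: nextv_lt xy ym.
rewrite /rot_ends /=; case: eqP => h; split=> /=; try lia.
- by apply: touch_in_sym; move: C'; rewrite /nextv h eqxx -/(nextv m x) -/(nextv m 0) /contact nxx.
- by move: C'; rewrite nxx /nextv; case: (y.+1 =P m).
Qed.

Lemma rot_crossing m d e : (d.1 < d.2 < m)%N -> (e.1 < e.2 < m)%N ->
  crossing d e -> crossing (rot_ends m d) (rot_ends m e).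
Proof.
case: d e => [a b] [a' b'] /=; rewrite /rot_ends /crossing /=.
by case: eqP => h; case: eqP => h' /=; lia.
Qed.

Lemma rot_walk m V k c : walk m V k c -> walk m (rot_vertices m V) k (fun t => rot_ends m (c t)).
Proof.
move=> [p ch cr]; split=> t; first by rewrite p.
  exact: rot_chord.
apply: rot_crossing => //; first by have [-> ->] := ch t.
by have [-> ->] := ch t.+1.
Qed.

(* Forgetting vertex 1 merges the sides 0 and 1. *)
Definition merge_first V i := if i == 0%N then V 0%N else V i.+1.
Definition merge_first_ends (d : nat * nat) := (d.1.-1, d.2.-1).

Lemma merge_polygon m V : polygon P m.+1 V -> polygon P m (merge_first V).
Proof.
move=> [H E]; split=> [i j k ij jk km|i im]; last first.
  by rewrite /merge_first; case: eqP => _; apply: E; lia.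
rewrite /merge_first (gtn_eqF (leq_ltn_trans (leq0n i) ij)).
rewrite (gtn_eqF (leq_ltn_trans (leq0n j) jk)).
by case: eqP => [i0|i0]; apply: H; lia.
Qed.

Lemma merge_chord m V d : (2 < m)%N -> polygon P m.+1 V -> (d.1.+1 < d.2)%N ->
  chord P m.+1 V d -> chord P m (merge_first V) (merge_first_ends d).
Proof.
case: d => [x y] m2 HP /= xy [/= _ ym C].
have y0 : (0 < y)%N by lia.
split=> /=; [lia|lia|].
have Vy : merge_first V y.-1 = V y by rewrite /merge_first; case: eqP => h; [lia|rewrite prednK].
have Vny : merge_first V (nextv m y.-1) = V (nextv m.+1 y).
  rewrite /nextv prednK// eqSS; case: eqP => // h; rewrite /merge_first; case: eqP => //; lia.
rewrite /contact Vy Vny.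
have nx0 : nextv m 0 = 1%N by rewrite /nextv; case: eqP => //; lia.
move: C; rewrite /contact (@nextv_lt _ x y)//; last lia.
case: x xy => [|[|x]] xy C /=.
- rewrite nx0 /merge_first /=; apply: (@arc_merge _ P convP m.+1 V 0 0 2 y) => //; lia.
- rewrite nx0 /merge_first /=; apply: (@arc_merge _ P convP m.+1 V 0 1 2 y) => //; lia.
- have -> : nextv m x.+1 = x.+2 by rewrite /nextv; case: eqP => //; lia.
  by [].
Qed.

(** The only crossings lost are those of a chord at side 0 with a chord at side 1, since both then
    end at the merged side. *)
Lemma merge_walk m V k c : (2 < m)%N -> polygon P m.+1 V ->
  (forall t, ~~ (((c t).1 == 0%N) && ((c t.+1).1 == 1%N))) ->
  (forall t, ~~ (((c t).1 == 1%N) && ((c t.+1).1 == 0%N))) ->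
  walk m.+1 V k c -> walk m (merge_first V) k (fun t => merge_first_ends (c t)).
Proof.
move=> m2 HP n01 n10 [p ch cr]; split=> t; first by rewrite p.
  apply: merge_chord => //; move: (cr t); have [h1 _ _] := ch t; rewrite /crossing; lia.
have := cr t; have := n01 t; have := n10 t; rewrite /crossing /merge_first_ends /=.
have [? _ _] := ch t; have [? _ _] := ch t.+1; lia.
Qed.

Lemma shift_walk m V k c j : walk m V k c -> walk m V k (fun t => c (j + t)%N).
Proof.
by move=> [p ch cr]; split=> t //; [rewrite addnA p|rewrite addnS].
Qed.

Lemma walk_addM m V k c t n : walk m V k c -> c (t + n * k)%N = c t.
Proof.
move=> [p _ _]; elim: n => [|n IH]; first by rewrite addn0.
by rewrite mulSn addnCA addnC p.
Qed.

Lemma walk_mod m V k c t : walk m V k c -> c t = c (t %% k)%N.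
Proof. by move=> w; rewrite {1}(divn_eq t k) addnC (walk_addM _ _ w). Qed.

(** Modulo k, multiplication by k - 1 is a change of sign. *)
Lemma reverse_walk m V k c : (0 < k)%N -> walk m V k c ->
  walk m V k (fun t => c (t * k.-1)%N).
Proof.
move=> k0 w; have [p ch cr] := w; split=> t //.
  by rewrite mulnDl (mulnC k) (walk_addM _ _ w).
rewrite mulSn addnC crossingC; have := cr (t * k.-1 + k.-1)%N.
by rewrite -addnS prednK// p.
Qed.

Lemma shortcut m V k c s d : (0 < d)%N -> walk m V k c ->
  crossing (c (s + d.-1)%N) (c s) -> walk m V d (fun r => c (s + r %% d)%N).
Proof.
move=> d0 [p ch cr] x; split=> t //; first by rewrite modnDr.
have := ltn_pmod t d0; have := modnS t d.
case: (boolP (d %| t.+1)%N) => dv -> td; last by rewrite addnS.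
rewrite addn0; have -> : (t %% d)%N = d.-1; last exact: x.
move: td; rewrite leq_eqVlt => /orP[/eqP h|h]; first by lia.
have h' : (t.+1 %% d = (t %% d).+1)%N by rewrite -[in LHS]addn1 -modnDml addn1 modn_small.
by move: dv; rewrite /dvdn h'.
Qed.

Section MinimalWalk.
Variables (m k : nat) (V : nat -> R * R) (c : nat -> nat * nat).
Hypothesis IH : forall m' V' k' c', (m' + k' < m.+1 + k)%N -> polygon P m' V' -> odd k' ->
  walk m' V' k' c' -> False.
Hypotheses (HP : polygon P m.+1 V) (ok : odd k) (k5 : (4 < k)%N) (w : walk m.+1 V k c).

(** Such a crossing splits the walk into closed walks of lengths e + 1 and k - e + 1; as k is odd,
    one of them is odd, and both are shorter. *)
Lemma chordless s e : (1 < e)%N -> (e.+1 < k)%N -> ~~ crossing (c s) (c (s + e)%N).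
Proof.
move=> e1 ek; apply/negP => x.
have [p _ _] := w.
case: (boolP (odd e)) => oe.
  apply: (IH (k' := (k - e).+1) _ HP _ (shortcut _ w (s := (s + e)%N) _)) => //=.
  - by lia.
  - by rewrite oddB ?ok ?oe//; lia.
  - by rewrite -addnA subnKC ?p//; lia.
apply: (IH (k' := e.+1) _ HP _ (shortcut _ w (s := s) _)) => //=; first by lia.
by rewrite crossingC.
Qed.

(** A repeated chord splits the walk into closed walks of lengths e and k - e, one of them odd. *)
Lemma walk_neq s e : (1 < e)%N -> (e.+1 < k)%N -> c s <> c (s + e)%N.
Proof.
move=> e1 ek E; have [p _ cr] := w.
case: (boolP (odd e)) => oe.
  apply: (IH (k' := e) _ HP _ (shortcut _ w (s := s) _)) => //; [lia|lia|].
  by rewrite E; have -> : (s + e = (s + e.-1).+1)%N by [lia]; exact: cr.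
apply: (IH (k' := (k - e)%N) _ HP _ (shortcut _ w (s := (s + e)%N) _)) => //; try lia.
rewrite -E -(p s); have -> : (s + k = (s + e + (k - e).-1).+1)%N by lia.
exact: cr.
Qed.

Hypothesis short0 : forall i, (i < m.+1)%N ->
  sqd (V 0%N) (V (nextv m.+1 0)) <= sqd (V i) (V (nextv m.+1 i)).

(* Merging the side 0 with the side 1 or with the side m yields a smaller walk
   unless c 1 joins these two sides; then c 0, c 1 and c 2 form the configuration
   of [smallest_side]. *)
Lemma nested_false : (c 0).1 = 0%N -> ((c 1).1 <= (c k.-1).1)%N ->
  ((c k.-1).2 <= (c 1).2)%N -> False.
Proof.
have [p ch cr] := w.
move=> c00 n1 n2; set x := (c 1).1 in n1; set y := (c 1).2 in n2.
have [c0l c0m C0] := ch 0%N; have [c1l c1m C1] := ch 1%N; have [c2l c2m C2] := ch 2%N.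
have := cr 0%N; have := cr 1%N; rewrite /crossing -/x -/y in c1l c1m C1 * => x12 x01.
have xx : (0 < x)%N /\ (x < (c 0).2)%N /\ ((c 0).2 < y)%N by lia.
(* The induction descends from [c k.-1] to [c 3]: a chord that crosses one nested in [c 1], but not
   [c 1] itself, is nested in [c 1] as well. *)
have inside i : (i + 3 < k)%N -> (x <= (c (k.-1 - i)).1)%N /\ ((c (k.-1 - i)).2 <= y)%N.
  elim: i => [_|i IHi ik]; first by rewrite subn0.
  have [|i1 i2] := IHi; first by lia.
  have E : (k.-1 - i = (k.-1 - i.+1).+1)%N by lia.
  rewrite E in i1 i2; set t := (k.-1 - i.+1)%N in i1 i2 *.
  have t3 : (2 < t)%N by rewrite /t; lia.
  have tk : (t < k.-1)%N by rewrite /t; lia.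
  have nc := @chordless 1 t.-1; rewrite add1n prednK in nc; last lia.
  have := cr t; have [tl _ _] := ch t.
  have [tl' _ _] := ch t.+1.
  have : ~~ crossing (c 1) (c t) by apply: nc; lia.
  rewrite /crossing -/x -/y; lia.
have outside t : ((c t).1 < x)%N || (y < (c t).2)%N -> (t %% k == 0)%N || (t %% k == 2)%N.
  rewrite (walk_mod _ w) => o; set r := (t %% k)%N in o *.
  have rk : (r < k)%N by rewrite ltn_pmod//; lia.
  have [r1|r1] := eqVneq r 1%N; first by move: o; rewrite r1 -/x -/y; lia.
  have [r3|r3] := ltnP 2 r; last by lia.
  have [|a b] := inside (k.-1 - r)%N; first by lia.
  have E : (k.-1 - (k.-1 - r) = r)%N by lia.
  by rewrite E in a b; lia.
(* Since k > 4, the residues 0 and 2 are not consecutive modulo k. *)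
have consec t : (t %% k == 0)%N || (t %% k == 2)%N -> (t.+1 %% k == 0)%N || (t.+1 %% k == 2)%N -> False.
  have k0 : (0 < k)%N by lia.
  rewrite modnS; have := ltn_pmod t k0; case: (boolP (k %| t.+1)%N) => dv; last by lia.
  have : (t.+1 %% k == (t %% k).+1 %% k)%N by rewrite -addn1 -modnDml addn1.
  move: dv; rewrite /dvdn => /eqP -> h h1 h2 _.
  have : ((t %% k).+1 %% k = (t %% k).+1)%N by rewrite modn_small//; lia.
  by move=> h3; lia.
have m3 : (2 < m)%N by lia.
(* If 1 < x, chords at the sides 0 and 1 leave the range from x to y, so they are [c 0] or [c 2].
   These are not consecutive, hence merging the sides 0 and 1 loses no crossing. *)
have [x1|x1] := ltnP 1 x.
  apply: (IH _ (merge_polygon HP) ok (merge_walk m3 HP _ _ w)); first by lia.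
  - by move=> t; apply/negP => /andP[/eqP a /eqP b]; apply: (consec t); apply: outside; lia.
  - by move=> t; apply/negP => /andP[/eqP a /eqP b]; apply: (consec t); apply: outside; lia.
have {}x1 : x = 1%N by lia.
(* The same argument for the sides m and 0, which a rotation turns into the sides 0 and 1. *)
have [ym|ym] := ltnP y m.
  have HPr := rot_polygon (ltn0Sn m) HP.
  have wr := rot_walk w.
  have rot0 t : (rot_ends m.+1 (c t)).1 = 0%N -> (y < (c t).2)%N.
    by rewrite /rot_ends; case: eqP => //= h _; lia.
  have rot1 t : (rot_ends m.+1 (c t)).1 = 1%N -> ((c t).1 < x)%N.
    by rewrite /rot_ends; case: eqP => //= h; lia.
  apply: (IH _ (merge_polygon HPr) ok (merge_walk m3 HPr _ _ wr)); first by lia.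
  - move=> t; apply/negP => /andP[/eqP /rot0 a /eqP /rot1 b].
    by apply: (consec t); apply: outside; rewrite ?a ?b ?orbT.
  - move=> t; apply/negP => /andP[/eqP /rot1 a /eqP /rot0 b].
    by apply: (consec t); apply: outside; rewrite ?a ?b ?orbT.
have {}ym : y = m by lia.
have c20 : (c 2).1 = 0%N by lia.
have neq : (c 0).2 <> (c 2).2.
  move=> E; apply: (@walk_neq 0 2) => //; first by lia.
  by rewrite add0n [LHS]surjective_pairing [RHS]surjective_pairing c00 c20 E.
have nx0 : nextv m.+1 0 = 1%N by rewrite /nextv; case: eqP => //; lia.
have nx1 : nextv m.+1 1 = 2%N by rewrite /nextv; case: eqP => //; lia.
have nxm : nextv m.+1 m = 0%N by rewrite /nextv eqxx.
have s1 := @short0 1; rewrite nx0 nx1 in s1.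
have s2 := @short0 m; rewrite nx0 nxm in s2.
rewrite c00 in C0; rewrite c20 in C2; rewrite x1 ym in C1.
have main b b' : (1 < b)%N -> (b < b')%N -> (b' < m)%N ->
    contact P m.+1 V 0 b -> contact P m.+1 V 0 b' -> False.
  by move=> h1 h2 h3 k1 k2; apply: (@smallest_side _ P convP m.+1 V b b') => //; [apply: s1; lia|exact: s2].
have [lt|ge] := ltnP (c 0).2 (c 2).2.
  by apply: (main (c 0).2 (c 2).2) => //; lia.
by apply: (main (c 2).2 (c 0).2) => //; lia.
Qed.
End MinimalWalk.
End Walks.

(** * Two-colouring in the absence of odd closed walks *)

Section TwoColouring.
Variables (T : finType) (e : rel T).
Hypothesis eC : symmetric e.
Hypothesis no_odd : forall k (c : nat -> T), odd k -> (forall t, c (t + k)%N = c t) ->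
  (forall t, e (c t) (c t.+1)) -> False.

(* In this double cover of the graph, a path between the two lifts of a vertex is
   an odd closed walk. *)
Let cover : rel (T * bool) := fun a b => e a.1 b.1 && (b.2 == ~~ a.2).

Let coverC : connect_sym cover.
Proof.
apply: sym_connect_sym => -[x b] [y b'] /=.
by rewrite /cover /= eC; case: b b' => [] [].
Qed.

Let odd_path x : ~~ connect cover (x, false) (x, true).
Proof.
apply/negP => /connectP[p pp lp].
have par q a : path cover a q -> (last a q).2 = odd (size q) (+) a.2.
  elim: q a => [a|b q IH a] //= /andP[/andP[_ /eqP ab] /IH ->].
  by rewrite ab; case: (a.2); case: (odd _).
have := par _ _ pp; rewrite -lp /= addbF => ok.
have k0 : (0 < size p)%N by case: (p) ok.
pose c t := (nth (x, false) ((x, false) :: p) (t %% size p)%N).1.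
apply: (no_odd (c := c) (esym ok)) => t; first by rewrite /c modnDr.
have st i : (i < size p)%N ->
    e (nth (x, false) ((x, false) :: p) i).1 (nth (x, false) p i).1.
  by move=> ip; have /pathP := pp => /(_ (x, false) i ip) /andP[].
have tp := ltn_pmod t k0.
rewrite /c modnS; case: (boolP (_ %| _)%N) => dv; last exact: st.
have -> : (nth (x, false) ((x, false) :: p) 0).1 = (nth (x, false) p (t %% size p)%N).1.
  have -> : (t %% size p = (size p).-1)%N.
    move: tp; rewrite leq_eqVlt => /orP[/eqP h|h]; first by lia.
    have h' : (t.+1 %% size p = (t %% size p).+1)%N.
      by rewrite -[in LHS]addn1 -modnDml addn1 modn_small.
    by move: dv; rewrite /dvdn h'.
  by rewrite nth_last -lp.
exact: st.
Qed.

Lemma two_colouring : exists f : T -> bool, forall x y, e x y -> f x != f y.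
Proof.
pose r' x := fingraph.root e x.
have ceC : connect_sym e by exact: sym_connect_sym.
(* One of the two lifts of x is reachable from the chosen lift of its root, by [one] below, and by
   [odd_path] not both; an edge changes which one it is. *)
pose f x := connect cover (r' x, false) (x, true).
exists f => x y xy.
have rxy : r' x = r' y by apply/eqP; rewrite (fingraph.root_connect ceC); exact: connect1.
have flip z a b : connect cover (z, a) (x, b) = connect cover (z, a) (y, ~~ b).
  have h : connect cover (x, b) (y, ~~ b) by apply: connect1; rewrite /cover /= xy eqxx.
  exact: (same_connect_r coverC h).
have one : connect cover (r' x, false) (x, false) || connect cover (r' x, false) (x, true).
  have /connectP[p pp E] : connect e (r' x) x by rewrite ceC connect_root.
  move: (r' x) p pp E => y'; clear; move=> p pp ->.
  elim/last_ind: p pp => [|p z IH]; first by rewrite connect0.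
  rewrite rcons_path last_rcons => /andP[/IH + ez].
  by case/orP => h; apply/orP; [right|left]; apply: connect_trans h _; apply: connect1; rewrite /cover /= ez.
rewrite /f -rxy; have -> : connect cover (r' x, false) (y, true) = connect cover (r' x, false) (x, false).
  by rewrite flip.
case: (boolP (connect cover _ (x, true))) one => [h1 _|h1]; last by rewrite orbF => ->.
apply/negP => /eqP/esym h2.
have := odd_path x; rewrite (connect_trans _ h1)// coverC; exact: h2.
Qed.
End TwoColouring.

(** * Exclusion of odd closed walks of crossings *)

Section NoOddWalk.
Variable R : rcfType.
Variable P : R * R -> Prop.
Hypothesis convP : forall x y (t : R), P x -> P y -> 0 <= t -> t <= 1 -> P (comb t x y).
Implicit Types (V : nat -> R * R) (c : nat -> nat * nat).

Lemma exists_min (f : nat -> R) m : exists v, (v < m.+1)%N /\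
  forall i, (i < m.+1)%N -> f v <= f i.
Proof.
elim: m => [|m [v [vm h]]]; first by exists 0%N; split=> // -[].
have [le|lt] := leP (f v) (f m.+1).
  exists v; split=> [|i]; first exact: ltnW.
  by rewrite ltnS leq_eqVlt => /orP[/eqP->//|]; exact: h.
exists m.+1; split=> // i; rewrite ltnS leq_eqVlt => /orP[/eqP->//|im].
exact: le_trans (ltW lt) (h _ im).
Qed.

Definition side_sqr m V i := sqd (V i) (V (nextv m i)).

Lemma side_sqr_rot m V i : (i < m)%N -> side_sqr m (rot_vertices m V) (nextv m i) = side_sqr m V i.
Proof. by move=> im; rewrite /side_sqr !rot_vertices_nextv// nextv_ltn. Qed.

(** A rotation raises the index v of a shortest side by one, until it wraps around to 0; hence the
    induction on m + 1 - v. *)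
Lemma rotate_min m k V c : polygon P m.+1 V -> walk P m.+1 V k c ->
  exists V' c', [/\ polygon P m.+1 V', walk P m.+1 V' k c' &
    forall i, (i < m.+1)%N -> side_sqr m.+1 V' 0 <= side_sqr m.+1 V' i].
Proof.
have [v [vm h]] := exists_min (side_sqr m.+1 V) m.
move: {2}(m.+1 - v)%N (leqnn (m.+1 - v)) => d.
elim: d V c v vm h => [|d IH] V c v vm h vd HP w; first by lia.
have [v0|v0] := eqVneq v 0%N; first by exists V, c; split=> //; rewrite -v0.
have nxv := nextv_ltn vm.
have hr i : (i < m.+1)%N -> side_sqr m.+1 (rot_vertices m.+1 V) (nextv m.+1 v) <= side_sqr m.+1 (rot_vertices m.+1 V) i.
  move=> im; rewrite side_sqr_rot//.
  pose j := if i == 0%N then m else i.-1.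
  have jm : (j < m.+1)%N by rewrite /j; case: eqP; lia.
  have -> : i = nextv m.+1 j by rewrite /nextv /j; case: (i =P 0%N) => h0; case: eqP; lia.
  by rewrite side_sqr_rot// h.
have [E|E] := eqVneq v.+1 m.+1.
  exists (rot_vertices m.+1 V), (fun t => rot_ends m.+1 (c t)); split.
  - exact: rot_polygon.
  - exact: rot_walk.
  - by move=> i im; have := hr i im; rewrite /nextv E eqxx.
apply: (IH (rot_vertices m.+1 V) (fun t => rot_ends m.+1 (c t)) (nextv m.+1 v)) => //.
- by rewrite /nextv (negPf E); lia.
- exact: rot_polygon.
- exact: rot_walk.
Qed.

(** Induction on m + k, because shortcuts decrease k and merging decreases m. Length 1 is a chord
    crossing itself, length 3 is [three_crossing]. *)
Lemma no_odd_walk m V k c : polygon P m V -> odd k -> walk P m V k c -> False.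
Proof.
move: {2}(m + k)%N (leqnn (m + k)) => N; elim: N m V k c => [|N IHN] m V k c mk HP ok w.
  by case: k ok mk w => //; lia.
have [p ch cr] := w.
have irr d : ~~ crossing d d by rewrite /crossing !ltnn.
have [k1|k1] := eqVneq k 1%N.
  have := cr 0%N; have := p 0%N; rewrite k1 add0n => ->.
  by apply/negP; exact: irr.
have [k3|k3] := eqVneq k 3%N.
  have := p 0%N; rewrite k3 add0n => p3.
  apply: (@three_crossing _ P convP m V (c 0) (c 1) (c 2)) => //.
  by rewrite crossingC -p3.
have k5 : (4 < k)%N by case: k ok k1 k3 {mk w p} => [|[|[|[|[|k]]]]].
case: m V HP mk w ch => [|m] V HP mk w ch; first by have [_] := ch 0%N; rewrite ltn0.
have [V' [c' [HP' w' s0]]] := rotate_min HP w.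
have IH m' V'' k' c'' : (m' + k' < m.+1 + k)%N -> polygon P m' V'' -> odd k' -> walk P m' V'' k' c'' -> False.
  by move=> l; apply: IHN; lia.
clear V c HP w p ch cr; have [p ch cr] := w'.
have k0 : (0 < k)%N by lia.
have m2 : (2 < m)%N.
  by have := cr 0%N; have [_ ? _] := ch 0%N; have [_ ? _] := ch 1%N; rewrite /crossing; lia.
(* Without a chord at side 0, merging the sides 0 and 1 loses no crossing. *)
have [hs|hs] := boolP (has (fun t => (c' t).1 == 0%N) (iota 0 k)); last first.
  have n0 t : (c' t).1 != 0%N.
    rewrite (walk_mod _ w'); apply: contra hs => h; apply/hasP.
    by exists (t %% k)%N => //; rewrite mem_iota /= ltn_pmod.
  apply: (IH _ _ _ _ _ (merge_polygon HP') ok (merge_walk convP m2 HP' _ _ w')); first by lia.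
  - by move=> t; rewrite (negPf (n0 t)).
  - by move=> t; rewrite (negPf (n0 t.+1)) andbF.
have [j _ /eqP cj] := hasP hs.
pose d t := c' (j + t)%N.
have wd : walk P m.+1 V' k d := shift_walk j w'.
have d0 : (d 0%N).1 = 0%N by rewrite /d addn0.
have [pd chd crd] := wd.
have nc : ~~ crossing (d 1%N) (d (1 + (k - 2))%N).
  by apply: (chordless IH HP' ok k5 wd); lia.
rewrite (_ : 1 + (k - 2) = k.-1)%N in nc; last by lia.
have x1 := crd 0%N; have x2 := crd k.-1; rewrite prednK// -{2}(add0n k) pd in x2.
have [l1 _ _] := chd 1%N; have [l2 _ _] := chd k.-1; have [l0 _ _] := chd 0%N.
(* Both [d 1] and [d k.-1] cross [d 0] but not each other, so one is nested in the other; reversing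
   the walk exchanges them. *)
have [n1|n1] := boolP (((d 1%N).1 <= (d k.-1).1) && ((d k.-1).2 <= (d 1%N).2))%N.
  by case/andP: n1 => n1 n2; exact: (nested_false convP IH HP' ok k5 wd s0 d0 n1 n2).
have rw := reverse_walk k0 wd.
have e1 : d (k.-1 * k.-1)%N = d 1%N.
  have -> : (k.-1 * k.-1 = 1 + (k - 2) * k)%N by nia.
  exact: walk_addM wd.
apply: (nested_false convP IH HP' ok k5 rw s0); rewrite ?mul0n ?mul1n ?e1//.
- by move: nc x1 x2 n1; rewrite /crossing; lia.
- by move: nc x1 x2 n1; rewrite /crossing; lia.
Qed.
End NoOddWalk.

(** * Cyclic order of the sides *)

Section Ordering.
Variable R : rcfType.
Variable P : R * R -> Prop.
Hypothesis convP : forall x y (t : R), P x -> P y -> 0 <= t -> t <= 1 -> P (comb t x y).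

Lemma extreme_det_neq0 a b c : extreme P a -> extreme P b -> extreme P c ->
  a <> b -> c <> a -> c <> b -> det a b c != 0.
Proof.
move=> Ea Eb [Pc Ec] ab ca cb; apply/eqP => d0.
have [t [t0 t1 E]] := on_chord Ea Eb ab Pc d0.
have [t00|tn0] := eqVneq t 0; first by apply: ca; rewrite E t00 comb0.
have [t11|tn1] := eqVneq t 1; first by apply: cb; rewrite E t11 comb1.
apply: ab; apply: (Ec a b t) E; try (by case: Ea); try (by case: Eb).
- by rewrite lt_def tn0.
- by rewrite lt_def eq_sym tn1.
Qed.

(** Otherwise b would be inside the triangle o a c, hence strictly between o and the point [y] where
    the ray from o through b meets [a, c]. *)
Lemma extreme_triangle o a b c : extreme P b -> P o -> P a -> P c -> b <> o ->
  0 < det o a b -> 0 < det o b c -> 0 < det o a c -> 0 <= det a b c.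
Proof.
move=> [Pb Eb] Po Pa Pc bo h1 h2 h3; rewrite leNgt; apply/negP => h4.
have E4 : det a b c = det o a b + det o b c - det o a c by rewrite /det; ring.
pose q := det o a b + det o b c.
have q0 : 0 < q by rewrite addr_gt0.
have qr : q < det o a c by rewrite /q; lra.
pose y := comb (det o a b / q) a c.
have yP : P y.
  apply: convP => //; first by rewrite divr_ge0 ?ltW.
  by rewrite ler_pdivrMr// mul1r /q; lra.
have by_ : b = comb (q / det o a c) o y.
  have q1 : q != 0 by rewrite gt_eqF.
  have r1 : det o a c != 0 by rewrite gt_eqF.
  have bary (f : R * R -> R) : f b * det o a c = f o * (det o a c - q) + f a * det o b c + f c * det o a b ->
      f b = (1 - q / det o a c) * f o + q / det o a c * ((1 - det o a b / q) * f a + det o a b / q * f c).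
    move=> h; apply: (mulIf r1); rewrite h /q; field.
    by rewrite r1 -/q q1.
  rewrite [LHS]surjective_pairing /y /comb /=; congr pair.
    by apply: (bary fst); rewrite /q /det; ring.
  by apply: (bary snd); rewrite /q /det; ring.
have oy : o = y.
  apply: (Eb o y _ Po yP _ _ by_); first by rewrite divr_gt0// (lt_trans q0).
  by rewrite ltr_pdivrMr ?mul1r// (lt_trans q0).
apply: bo; rewrite by_ -oy [RHS]surjective_pairing /comb; congr pair; ring.
Qed.

Variables (n : nat) (u w : 'I_n -> R * R).
Hypothesis n2 : (2 < n)%N.
Hypothesis uP : forall i, P (u i).
Hypothesis wP : forall i, P (w i).
Hypothesis uw : forall i, u i <> w i.
Hypothesis leftP : forall i x, P x -> 0 <= det (u i) (w i) x.
Hypothesis onP : forall i x, P x -> det (u i) (w i) x = 0 ->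
  exists t : R, [/\ 0 <= t, t <= 1 & x = comb t (u i) (w i)].
Hypothesis line_inj : forall i j, det (u i) (w i) (u j) = 0 -> det (u i) (w i) (w j) = 0 -> j = i.

Lemma comb_start (t : R) a b : a <> b -> a = comb t a b -> t = 0.
Proof.
case: a b => [a1 a2] [b1 b2] ab [] e1 e2; apply/eqP; apply/negPn/negP => t0; apply: ab.
by congr pair; apply: (mulfI t0); lra.
Qed.

Lemma start_extreme i : extreme P (u i).
Proof.
split=> // x y t Px Py t0 t1 E.
have := det_comb (u i) (w i) t x y; rewrite -E det_l => dE.
have dx := leftP i Px; have dy := leftP i Py.
have h1 : 0 <= (1 - t) * det (u i) (w i) x by rewrite mulr_ge0//; lra.
have h2 : 0 <= t * det (u i) (w i) y by rewrite mulr_ge0// ltW.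
have d1 : det (u i) (w i) x = 0.
  have t1' : 1 - t != 0 by rewrite subr_eq0 gt_eqF.
  by apply: (mulfI t1'); clear E; lra.
have d2 : det (u i) (w i) y = 0.
  have t0' : t != 0 by rewrite gt_eqF.
  by apply: (mulfI t0'); clear E; lra.
have [a [a0 a1 xE]] := onP Px d1; have [b [b0 b1 yE]] := onP Py d2.
have z : (1 - t) * a + t * b = 0.
  apply: (comb_start (@uw i)); rewrite [LHS]E xE yE /comb /=; congr pair; ring.
have ta : 0 <= (1 - t) * a by rewrite mulr_ge0//; lra.
have tb : 0 <= t * b by rewrite mulr_ge0// ltW.
have az : a = 0.
  have t1' : 1 - t != 0 by rewrite subr_eq0 gt_eqF.
  by apply: (mulfI t1'); clear E xE yE; lra.
have bz : b = 0.
  have t0' : t != 0 by rewrite gt_eqF.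
  by apply: (mulfI t0'); clear E xE yE; lra.
by rewrite xE yE az bz.
Qed.

(** If two sides start at the same point, each has the end of the other on its left, which forces
    both onto one line. *)
Lemma start_inj : injective u.
Proof.
move=> i j E; apply/esym/line_inj; first by rewrite -E det_l.
have h1 := leftP i (wP j); have h2 := leftP j (wP i).
apply/eqP; rewrite eq_le h1 andbT; by move: h2; rewrite -E detN oppr_ge0.
Qed.

Variable i0 : 'I_n.
Let r i j := det (u i0) (u i) (u j).
Let g i := det (u i0) (w i0) (u i).

Let r_neq0 i j : i != i0 -> j != i0 -> i != j -> r i j != 0.
Proof.
move=> a b c; apply: extreme_det_neq0; try exact: start_extreme;
  by move/start_inj => h; move: a b c; rewrite ?h ?eqxx// -?h ?eqxx.
Qed.

Let g_end i : i != i0 -> g i = 0 -> u i = w i0.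
Proof.
move=> ii h; have [t [t0 t1 E]] := onP (uP i) h.
have [t00|tn0] := eqVneq t 0.
  by move: E; rewrite t00 comb0 => /start_inj h'; move: ii; rewrite h' eqxx.
have [t11|tn1] := eqVneq t 1; first by rewrite E t11 comb1.
have [_ Eu] := start_extreme i.
case: (@uw i0); apply: (Eu _ _ t) E => //; first by rewrite lt_def tn0.
by rewrite lt_def eq_sym tn1.
Qed.

(** In the Plücker relation [pl] the weights g are heights over the line of side [i0]. They are
    nonnegative, and by [g_end] they do not vanish at both i and k. *)
Let r_trans i j k : i != i0 -> j != i0 -> k != i0 -> 0 < r i j -> 0 < r j k -> 0 < r i k.
Proof.
move=> i1 j1 k1 ij jk.
have pl : g j * r i k = g i * r j k + g k * r i j by rewrite /g /r /det; ring.
have gi : 0 <= g i := leftP i0 (uP i).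
have gj : 0 <= g j := leftP i0 (uP j).
have gk : 0 <= g k := leftP i0 (uP k).
have ik : i != k.
  by apply: contraTneq ij => ->; rewrite -leNgt /r detN oppr_le0; exact: ltW.
have pos : 0 < g i + g k.
  rewrite lt_def addr_ge0// andbT paddr_eq0//; apply: contra ik => /andP[/eqP a /eqP b].
  by apply/eqP/start_inj; rewrite (g_end i1 a) (g_end k1 b).
have X : 0 < g j * r i k.
  rewrite pl; case: (ltrP 0 (g i)) => [h|h].
    by apply: ltr_wpDr; [rewrite mulr_ge0// ltW|rewrite mulr_gt0].
  apply: ltr_wpDl; first by rewrite mulr_ge0// ltW.
  by rewrite mulr_gt0//; lra.
have gj0 : 0 < g j by rewrite lt_def gj andbT; apply: contraTneq X => ->; rewrite mul0r ltxx.
by rewrite -(pmulr_rgt0 _ gj0).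
Qed.

Let before i j := (i != j) && ((i == i0) || (j != i0) && (0 < r i j)).

Let before_trans i j k : before i j -> before j k -> before i k.
Proof.
rewrite /before; case: (eqVneq i i0) => [-> /andP[ij _] /andP[jk]|i1 /= /andP[ij /andP[j1 rij]]].
  rewrite eq_sym (negPf ij) /= => /andP[k1 _]; by rewrite eq_sym k1.
rewrite (negPf j1) /= => /andP[jk /andP[k1 rjk]].
have rik := r_trans i1 j1 k1 rij rjk; rewrite k1 rik !andbT.
by apply: contraTneq rik => ->; rewrite /r det_r ltxx.
Qed.

Let before_total i j : i != j -> before i j || before j i.
Proof.
rewrite /before => ij; rewrite ij (eq_sym j i) ij !andTb.
have [//|i1] := eqVneq i i0; have [|j1] := eqVneq j i0; first by rewrite orbT.
rewrite /= -/(r i j) -/(r j i); have -> : r j i = - r i j by rewrite /r detN.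
by rewrite oppr_gt0 -neq_lt eq_sym r_neq0.
Qed.

Let before_det i j k : before i j -> before j k -> 0 < det (u i) (u j) (u k).
Proof.
move=> ij jk; have ik := before_trans ij jk; move: ij jk ik; rewrite /before.
have [-> /andP[ij _] /andP[jk]|i1 /= /andP[ij /andP[j1 rij]]] := eqVneq i i0.
  by rewrite eq_sym (negPf ij) /= => /andP[_ h] _.
rewrite (negPf j1) /= => /andP[jk /andP[k1 rjk]] /andP[ik /andP[_ rik]].
rewrite lt_def (extreme_triangle _ _ _ _ _ rij rjk rik)//; last 2 first.
- exact: start_extreme.
- by move/start_inj => h; rewrite h eqxx in j1.
rewrite andbT; apply: extreme_det_neq0; try exact: start_extreme;
  by move/start_inj => h; move: ij jk ik; rewrite h eqxx.
Qed.

(** The starting points are sorted by angle around [u i0]. That [w i] is the next starting point is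
    never proved: as the side [u i, w i] is on the outer side of the chord from [u i] to the next
    start, [chord_of_arc] carries its contacts over to this chord. *)
Lemma order_sides : exists (V : nat -> R * R) (pos : 'I_n -> nat),
  [/\ injective pos, forall i, (pos i < n)%N, polygon P n V &
   forall i j, i != j -> touch_in P (u i) (w i) (u j) (w j) -> contact P n V (pos i) (pos j)].
Proof.
pose le i j := (i == j) || before i j.
have le_tot : total le.
  by move=> i j; rewrite /le (eq_sym j); case: (eqVneq i j) => //= /before_total.
have le_trans : transitive le.
  move=> j i k; rewrite /le; case: (eqVneq i j) => [->//|_] /= ij.
  by case: (eqVneq j k) => [<-|_ /= jk]; rewrite ?ij ?orbT// (before_trans ij jk) orbT.
pose s := sort le (enum 'I_n).
have su : uniq s by rewrite sort_uniq enum_uniq.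
have sz : size s = n by rewrite size_sort size_enum_ord.
have sin i : i \in s by rewrite mem_sort mem_enum.
have ss : sorted le s := sort_sorted le_tot _.
pose V k := u (nth i0 s k).
have bef a b : (a < b)%N -> (b < n)%N -> before (nth i0 s a) (nth i0 s b).
  move=> ab bn; have an := ltn_trans ab bn.
  have := sorted_ltn_nth le_trans i0 ss; move/(_ a b).
  rewrite !inE sz => /(_ an bn ab) /orP[|//].
  by rewrite nth_uniq ?sz// ltn_eqF.
have HP : polygon P n V.
  split=> [a b c ab bc cn|k kn]; last exact: start_extreme.
  by apply: before_det; apply: bef => //; exact: ltn_trans cn.
have posn i : (index i s < n)%N by rewrite -[ltnRHS]sz index_mem.
have Vi i : V (index i s) = u i by rewrite /V nth_index.
exists V, (fun i => index i s); split=> //.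
  by move=> i j E; rewrite -(nth_index i0 (sin i)) E nth_index.
have [H _] := HP.
have step i y y' : touch_in P (u i) (w i) (V y) y' -> (y < n)%N -> y != index i s ->
    touch_in P (V (index i s)) (V (nextv n (index i s))) (V y) y'.
  move=> t yn; move: (posn i) (Vi i); move: (index i s) => a an Va ya.
  have nn := nextv_ltn an.
  have VP k : P (V k) by exact: uP.
  apply: (chord_of_arc convP) (t) => //; try exact: start_extreme.
  - by move/start_inj/eqP; rewrite nth_uniq ?sz// /nextv; case: (a.+1 =P n) => h /eqP; lia.
  - by rewrite Va det_l.
  - by have := leftP i (VP (nextv n a)); rewrite Va detN oppr_ge0.
  - rewrite /nextv; case: (a.+1 =P n) => h.
      have h' : (y <= a)%N by lia.
      by have := chain_ge0 H (leq0n y) h' an; rewrite -det_cyc det_cyc det_cyc.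
    have an' : (a.+1 < n)%N by lia.
    case: (ltnP a y) => ay; first by apply: (chain_ge0 H (leqnSn a)).
    by have := chain_ge0 H ay (leqnSn a) an'; rewrite det_cyc.
move=> i j ij t.
have pij : index i s != index j s.
  by apply: contra ij => /eqP h; rewrite -(nth_index i0 (sin i)) h nth_index.
apply: touch_in_sym; apply: (step _) => //; apply: touch_in_sym; rewrite Vi.
have h := step i (index j s) (w j); rewrite Vi in h.
by have := h; rewrite !Vi => h'; apply: h' => //; rewrite eq_sym.
Qed.
End Ordering.

Local Open Scope classical_set_scope.

(** As q - p is orthogonal to (a, b), the determinant is proportional to the halfplane function; the
    sign of the factor [l] tells which endpoint comes first to have the region on the left. *)
Lemma orient_side (R : rcfType) (a b c : R) (p q : R * R) :
  (a, b) <> (0, 0) -> p <> q -> a * p.1 + b * p.2 = c -> a * q.1 + b * q.2 = c ->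
  exists u w : R * R, ((u = p /\ w = q) \/ (u = q /\ w = p)) /\
    exists2 k, 0 < k & forall x, det u w x = k * (c - (a * x.1 + b * x.2)).
Proof.
move=> ab pq hp hq.
have N0 : 0 < a * a + b * b.
  rewrite lt_def addr_ge0 ?mulrr_ge0// andbT; apply: contra_notN ab.
  rewrite paddr_eq0 ?mulrr_ge0// !mulf_eq0 !orbb => /andP[/eqP-> /eqP->] //.
pose l := a * (q.2 - p.2) - b * (q.1 - p.1).
have dE x : det p q x = l / (a * a + b * b) * (c - (a * x.1 + b * x.2)).
  apply: (mulIf (lt0r_neq0 N0)); rewrite mulrAC divfK ?gt_eqF//.
  have e : a * (q.1 - p.1) + b * (q.2 - p.2) = 0 by lra.
  rewrite -hp /l /det; apply/eqP; rewrite -subr_eq0; apply/eqP.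
  transitivity ((a * (q.1 - p.1) + b * (q.2 - p.2)) * (a * (x.2 - p.2) - b * (x.1 - p.1))); first by ring.
  by rewrite e mul0r.
have l0 : l != 0.
  apply: contra_notN pq => /eqP l0.
  have e : a * (q.1 - p.1) + b * (q.2 - p.2) = 0 by lra.
  have e1 : (a * a + b * b) * (q.1 - p.1) = 0.
    transitivity (a * (a * (q.1 - p.1) + b * (q.2 - p.2)) - b * l); first by rewrite /l; ring.
    by rewrite e l0 !mulr0 subr0.
  have e2 : (a * a + b * b) * (q.2 - p.2) = 0.
    transitivity (b * (a * (q.1 - p.1) + b * (q.2 - p.2)) + a * l); first by rewrite /l; ring.
    by rewrite e l0 !mulr0 addr0.
  have z1 : q.1 - p.1 = 0 by apply: (mulfI (lt0r_neq0 N0)); rewrite e1 mulr0.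
  have z2 : q.2 - p.2 = 0 by apply: (mulfI (lt0r_neq0 N0)); rewrite e2 mulr0.
  by rewrite [LHS]surjective_pairing [RHS]surjective_pairing; congr pair; lra.
have [lp|ln] := ltrP 0 l.
  by exists p, q; split; [left|exists (l / (a * a + b * b)) => //; rewrite divr_gt0].
exists q, p; split; [by right|exists (- (l / (a * a + b * b)))].
  by rewrite -mulNr divr_gt0// oppr_gt0 lt_def eq_sym l0.
by move=> x; rewrite mulNr -dE /det; ring.
Qed.

(** * From halfplanes and side disks to contacts of a polygon *)

Section Polygon.
Variable R : realType.

Lemma side_diskP (e : plane R * plane R) (z : R * R) : side_disk e z -> dt z e.1 e.2 <= 0.
Proof.
case: e => [[p1 p2] [q1 q2]]; case: z => z1 z2.
rewrite /side_disk /= /edist /midpoint /=.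
set A := (X in Num.sqrt X <= _); set B := (X in _ <= Num.sqrt X / 2) => h.
have A0 : 0 <= A by rewrite addr_ge0 ?sqr_ge0.
have B0 : 0 <= B by rewrite addr_ge0 ?sqr_ge0.
have : Num.sqrt A ^+ 2 <= (Num.sqrt B / 2) ^+ 2 by rewrite ler_sqr// nnegrE ?divr_ge0 ?sqrtr_ge0.
rewrite exprMn !sqr_sqrtr// => {}h.
have -> : dt (z1, z2) (p1, p2) (q1, q2) = A - B * 2^-1 ^+ 2.
  by rewrite /dt /A /B /= /GRing.scale /=; field.
by rewrite subr_le0.
Qed.

Lemma contact_positions n (P : set (plane R)) (s : 'I_n -> plane R * plane R) :
  (2 < n)%N -> convex_polygon P s ->
  (forall (x y : R * R) (t : R), P x -> P y -> 0 <= t -> t <= 1 -> P (comb t x y)) /\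
  exists (V : nat -> R * R) (pos : 'I_n -> nat),
  [/\ injective pos, forall i, (pos i < n)%N, polygon (P : R * R -> Prop) n V &
   forall i j, i != j -> side_disk (s i) `&` side_disk (s j) !=set0 ->
     contact (P : R * R -> Prop) n V (pos i) (pos j)].
Proof.
move=> n2 [_ _ _ [h [hh PE hs hl]]].
have PP (x : R * R) : P x <-> forall i, (h i).1.1 * x.1 + (h i).1.2 * x.2 <= (h i).2.
  by rewrite PE; split=> [H i|H i _]; exact: H.
have convP (x y : R * R) (t : R) : P x -> P y -> 0 <= t -> t <= 1 -> P (comb t x y).
  move=> /PP Px /PP Py t0 t1; apply/PP => i; rewrite /comb /=.
  have -> : (h i).1.1 * ((1 - t) * x.1 + t * y.1) + (h i).1.2 * ((1 - t) * x.2 + t * y.2) =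
     (1 - t) * ((h i).1.1 * x.1 + (h i).1.2 * x.2) + t * ((h i).1.1 * y.1 + (h i).1.2 * y.2) by ring.
  have -> : (h i).2 = (1 - t) * (h i).2 + t * (h i).2 by ring.
  by apply: lerD; apply: ler_wpM2l => //; rewrite subr_ge0.
split=> //.
have segE i (x : R * R) : (P x /\ (h i).1.1 * x.1 + (h i).1.2 * x.2 = (h i).2) <->
    exists t : R, [/\ 0 <= t, t <= 1 & x = comb t (s i).1 (s i).2].
  have [_ E] := hs i; split=> [hx|[t [t0 t1 ->]]].
    have : segment (s i).1 (s i).2 x by rewrite -E.
    by case=> t /andP[t0 t1] ->; exists t.
  have : segment (s i).1 (s i).2 (comb t (s i).1 (s i).2) by exists t; rewrite ?t0 ?t1.
  by rewrite -E => -[].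
have s1 i : P (s i).1 /\ (h i).1.1 * (s i).1.1 + (h i).1.2 * (s i).1.2 = (h i).2.
  by apply/segE; exists 0; rewrite comb0 lexx ler01.
have s2 i : P (s i).2 /\ (h i).1.1 * (s i).2.1 + (h i).1.2 * (s i).2.2 = (h i).2.
  by apply/segE; exists 1; rewrite comb1 lexx ler01.
have or i : exists uw : (R * R) * (R * R),
    ((uw.1 = (s i).1 /\ uw.2 = (s i).2) \/ (uw.1 = (s i).2 /\ uw.2 = (s i).1)) /\
    exists2 k, 0 < k & forall x, det uw.1 uw.2 x = k * ((h i).2 - ((h i).1.1 * x.1 + (h i).1.2 * x.2)).
  have [np _] := hs i; have [_ l1] := s1 i; have [_ l2] := s2 i.
  by have [u [w H]] := orient_side (hh i) np l1 l2; exists (u, w).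
have [uw Huw] := choice or.
pose u i := (uw i).1; pose w i := (uw i).2.
have ends i : ((u i = (s i).1 /\ w i = (s i).2) \/ (u i = (s i).2 /\ w i = (s i).1)) by case: (Huw i).
have dE i x : exists2 k, 0 < k & det (u i) (w i) x = k * ((h i).2 - ((h i).1.1 * x.1 + (h i).1.2 * x.2)).
  by have [_ [k k0 H]] := Huw i; exists k.
have d0E i x : det (u i) (w i) x = 0 -> (h i).1.1 * x.1 + (h i).1.2 * x.2 = (h i).2.
  have [k k0 ->] := dE i x => /eqP; rewrite mulf_eq0 gt_eqF//= subr_eq0 => /eqP->//.
have uP i : P (u i) by case: (ends i) => -[-> _]; [case: (s1 i)|case: (s2 i)].
have wP i : P (w i) by case: (ends i) => -[_ ->]; [case: (s2 i)|case: (s1 i)].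
have nuw i : u i <> w i by have [np _] := hs i; case: (ends i) => -[-> ->] //; exact: nesym.
have leftP i x : P x -> 0 <= det (u i) (w i) x.
  move=> /PP /(_ i) Px; have [k k0 ->] := dE i x.
  by rewrite pmulr_rge0// subr_ge0.
have onP i x : P x -> det (u i) (w i) x = 0 ->
    exists t : R, [/\ 0 <= t, t <= 1 & x = comb t (u i) (w i)].
  move=> Px /d0E e; have [t [t0 t1 ->]] := (segE i x).1 (conj Px e).
  case: (ends i) => -[-> ->]; first by exists t.
  exists (1 - t); split; [by rewrite subr_ge0|by rewrite gerBl|].
  by rewrite /comb; congr pair; ring.
have line_inj i j : det (u i) (w i) (u j) = 0 -> det (u i) (w i) (w j) = 0 -> j = i.
  move=> /d0E e1 /d0E e2; apply/hl => x [t _ ->]; rewrite /boundary_line /=.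
  have [f1 f2] : (h i).1.1 * (s j).1.1 + (h i).1.2 * (s j).1.2 = (h i).2 /\
      (h i).1.1 * (s j).2.1 + (h i).1.2 * (s j).2.2 = (h i).2.
    by case: (ends j) => -[E1 E2]; rewrite -E1 -E2.
  transitivity ((1 - t) * ((h i).1.1 * (s j).1.1 + (h i).1.2 * (s j).1.2) +
     t * ((h i).1.1 * (s j).2.1 + (h i).1.2 * (s j).2.2)).
    by rewrite /GRing.scale /=; ring.
  by rewrite f1 f2; ring.
have i0 : 'I_n := Ordinal (ltn_trans (ltn0Sn 1) n2).
have [V [pos [pi pn HV HC]]] := order_sides convP n2 uP wP nuw leftP onP line_inj i0.
exists V, pos; split=> // i j ij [z [/side_diskP zi /side_diskP zj]].
apply: HC => //.
have dtE k y : dt y (u k) (w k) = dt y (s k).1 (s k).2.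
  by case: (ends k) => -[-> ->] //; exact: dtC.
have T : touch (u i) (w i) (u j) (w j) by exists z; rewrite !dtE.
(* The given common point may be outside P. The one supplied here lies between the midpoints of two
   sides, hence in P by convexity. *)
have [t [t0 t1 h1 h2]] := touch_mid T.
exists (between_mids t (u i) (w i) (u j) (w j)); split=> //.
have half0 : 0 <= 2^-1 :> R by rewrite invr_ge0.
have half1 : 2^-1 <= 1 :> R by rewrite invf_le1// ler1n.
have -> : between_mids t (u i) (w i) (u j) (w j) =
    comb t (comb 2^-1 (u i) (w i)) (comb 2^-1 (u j) (w j)).
  by rewrite /between_mids /comb /=; congr pair; field.
by apply: (convP) => //; apply: (convP).
Qed.
End Polygon.

(** * Two-page drawings *)

Lemma two_pages (R : rcfType) (P : R * R -> Prop) n V :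
  (forall x y (t : R), P x -> P y -> 0 <= t -> t <= 1 -> P (comb t x y)) -> polygon P n V ->
  exists f : nat * nat -> bool, forall c d, chord P n V c -> chord P n V d ->
    crossing c d -> f c != f d.
Proof.
case: n => [|n] convP HP; first by exists xpredT => c d [].
pose v (c : 'I_n.+1 * 'I_n.+1) : nat * nat := (val c.1, val c.2).
(* The colouring needs a finite type, so all pairs of indices are vertices; those that are not
   contacts are isolated. *)
pose e : rel ('I_n.+1 * 'I_n.+1) := fun c d =>
  [&& crossing (v c) (v d), `[<chord P n.+1 V (v c)>] & `[<chord P n.+1 V (v d)>]].
have eC : symmetric e by move=> c d; rewrite /e crossingC; congr andb; rewrite andbC.
have [|f Hf] := two_colouring eC.
  move=> k c ok ck ce; apply: (no_odd_walk convP HP ok (c := fun t => v (c t))).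
  split=> t; first by rewrite ck.
    by have /and3P[_ /asboolP] := ce t.
  by have /and3P[] := ce t.
exists (fun c => f (inord c.1, inord c.2)) => c d Cc Cd cd; apply: Hf.
have vK x : chord P n.+1 V x -> v (inord x.1, inord x.2) = x.
  case: x => a b [/= ab bn _]; rewrite /v /= !inordK//; exact: ltn_trans bn.
by rewrite /e !vK// cd /=; apply/andP; split; apply/asboolP.
Qed.

Lemma parabola_gt0 (R : realDomainType) (k m X : R) :
  k < m -> 0 < (X - k) * (m - X) -> k < X /\ X < m.
Proof. by move=> km h; split; rewrite ltNge; apply/negP => h'; nra. Qed.

(** Of two parabolas with the same leading coefficient, the one over the larger interval is strictly
    higher above the interior of the smaller one. *)
Lemma parabola_nested (R : realDomainType) (k k' m m' : nat) (X : R) :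
  (k <= k')%N -> (m' <= m)%N -> (k, m) <> (k', m') -> k'%:R < X -> X < m'%:R ->
  (X - k'%:R) * (m'%:R - X) < (X - k%:R) * (m%:R - X).
Proof.
move=> kk mm ne h1 h2.
have : (k < k')%N || (m' < m)%N.
  rewrite !ltnNge -negb_and; apply: contra_notN ne => /andP[k1 m1].
  by congr pair; apply/eqP; rewrite eqn_leq ?kk ?mm ?andbT.
move: kk mm; rewrite -!(ltr_nat R) -!(ler_nat R) => kk mm; clear ne.
have a0 : 0 < X - k'%:R by rewrite subr_gt0.
have b0 : 0 < m'%:R - X by rewrite subr_gt0.
have c0 : 0 < X - k%:R by rewrite subr_gt0 (le_lt_trans kk).
case/orP => h.
  apply: (@lt_le_trans _ _ ((X - k%:R) * (m'%:R - X))); first by rewrite ltr_pM2r// ltrD2l ltrN2.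
  by rewrite ler_pM2l// lerD2r.
apply: (@le_lt_trans _ _ ((X - k%:R) * (m'%:R - X))); first by rewrite ler_pM2r// lerD2l lerN2.
by rewrite ltr_pM2l// ltrD2r.
Qed.

Lemma overlap_nested k m k' m' : (k < m')%N -> (k' < m)%N -> ~~ crossing (k, m) (k', m') ->
  ~~ ((k <= k') && (m' <= m))%N -> (k' <= k)%N /\ (m <= m')%N.
Proof. by rewrite /crossing /=; lia. Qed.

Section TwoPageDrawing.
Variables (R : realType) (T : Type) (G : graph T) (x : T -> nat) (f : nat * nat -> bool).
Hypothesis x_inj : forall a b, vertices G a -> vertices G b -> x a = x b -> a = b.
Hypothesis f_crossing : forall a b a' b', adj G a b -> adj G a' b' ->
  (x a < x b)%N -> (x a' < x b')%N -> crossing (x a, x b) (x a', x b') ->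
  f (x a, x b) != f (x a', x b').

Let pt a : plane R := ((x a)%:R, 0).
(** The pages are the two sides of the horizontal axis. Sorting the ends makes the arc independent
    of the direction of the edge. *)
Let page a b : R := (-1) ^+ f (minn (x a) (x b), maxn (x a) (x b)).
Let height a b (X : R) := (X - (x a)%:R) * ((x b)%:R - X).
Let arc a b : set (plane R) := [set p | 0 <= height a b p.1 /\ p.2 = page a b * height a b p.1].

Let heightC a b X : height a b X = height b a X.
Proof. by rewrite /height; ring. Qed.

Let arcC a b : arc a b = arc b a.
Proof.
by apply/seteqP; split=> p; rewrite /arc /= heightC /page minnC maxnC.
Qed.

Let adj_neq a b : adj G a b -> x a != x b.
Proof.
move=> ab; have [va vb] := adj_vertices ab; apply/eqP => /(x_inj va vb) E.
by case: (@adj_irrefl _ G b); rewrite -{1}E.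
Qed.

Let height0 a b (z : nat) : height a b z%:R = 0 -> z = x a \/ z = x b.
Proof.
by move/eqP; rewrite mulf_eq0 !subr_eq0 !eqr_nat => /orP[] /eqP ->; [left|right].
Qed.

Let page_neq0 a b : page a b != 0.
Proof. by rewrite signr_eq0. Qed.

Let simple a b : adj G a b -> simple_arc (pt a) (pt b) (arc a b).
Proof.
move=> ab; have xab := adj_neq ab.
pose D : R := (x b)%:R - (x a)%:R.
have D0 : D != 0 by rewrite subr_eq0 eqr_nat eq_sym.
have DD : 0 < D * D by rewrite -expr2 lt_def sqrf_eq0 D0 sqr_ge0.
pose g (t : R) : plane R := ((x a)%:R + t * D, page a b * (t * (1 - t) * (D * D))).
have hg t : height a b (g t).1 = t * (1 - t) * (D * D) by rewrite /height /= /D; ring.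
exists g; split.
- apply: continuous_subspaceT => t.
  apply: (@cvg_pair R R^o R^o (nbhs t) (nbhs ((g t).1 : R^o)) (nbhs ((g t).2 : R^o)) _ _ _
    (fun r => (g r).1) (fun r => (g r).2)).
    apply: cvgD; first exact: cvg_cst.
    by apply: cvgM; [exact: cvg_id|exact: cvg_cst].
  apply: cvgM; first exact: cvg_cst.
  apply: cvgM; last exact: cvg_cst.
  apply: cvgM; first exact: cvg_id.
  by apply: cvgB; [exact: cvg_cst|exact: cvg_id].
- by move=> t t' _ _ [/addrI /(mulIf D0)].
- by rewrite /g /pt !mul0r mulr0 addr0.
- by rewrite /g /pt !mul1r subrr mul0r mulr0 /D addrC subrK.
- apply/seteqP; split=> [p [p0 p2]|_ [t + <-]]; last first.
    rewrite /= in_itv /= => /andP[t0 t1]; split; last by rewrite hg.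
    by rewrite hg; apply: mulr_ge0; [apply: mulr_ge0; rewrite ?subr_ge0|exact: ltW].
  pose t := (p.1 - (x a)%:R) / D.
  have tE : p.1 = (g t).1 by rewrite /g /t /= divfK// addrC subrK.
  have pE : g t = p by rewrite [RHS]surjective_pairing p2 tE hg.
  exists t => //; move: p0; rewrite tE hg pmulr_lge0// => p0.
  by rewrite /= in_itv /=; apply/andP; split; rewrite leNgt; apply/negP => h; nra.
Qed.

(** A meeting point of height 0 is a common endpoint. Elsewhere, arcs on different pages have
    opposite signs, and arcs on the same page do not cross, so their overlapping intervals are
    nested and the parabolas are separated. *)
Let meet_lt a b a' b' : adj G a b -> adj G a' b' -> (x a < x b)%N -> (x a' < x b')%N ->
  [set a; b] <> [set a'; b'] -> arc a b `&` arc a' b' `<=` pt @` ([set a; b] `&` [set a'; b']).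
Proof.
move=> ab ab' l l' ne p [[h0 p2] [h0' p2']].
have [va vb] := adj_vertices ab; have [va' vb'] := adj_vertices ab'.
have sq c d : page c d * page c d = 1 by rewrite -expr2 sqrr_sign.
have E : height a b p.1 = page a b * page a' b' * height a' b' p.1.
  by rewrite -mulrA -p2' p2 mulrA sq mul1r.
have [z|nz] := eqVneq (height a b p.1) 0.
  have z' : height a' b' p.1 = 0.
    by apply/eqP; move/eqP: E; rewrite z eq_sym !mulf_eq0 !(negPf (page_neq0 _ _)).
  have pz : p.2 = 0 by rewrite p2 z mulr0.
  have [c [vc cab pc]] : exists c, [/\ vertices G c, [set a; b] c & p = pt c].
    move/eqP: z; rewrite mulf_eq0 !subr_eq0 => /orP[/eqP e|/eqP e].
      by exists a; split=> //; [left|rewrite [LHS]surjective_pairing pz e].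
    by exists b; split=> //; [right|rewrite [LHS]surjective_pairing pz -e].
  exists c => //; split=> //; move: z'; rewrite pc => /height0[] /x_inj h.
    by left; apply: h.
  by right; apply: h.
exfalso; have hp : 0 < height a b p.1 by rewrite lt_def nz.
have hp' : 0 < height a' b' p.1.
  by rewrite lt_def h0' andbT; apply: contra_neq nz => z; rewrite E z mulr0.
have [fE|fN] := eqVneq (f (x a, x b)) (f (x a', x b')); last first.
  have : page a b * page a' b' = -1.
    rewrite /page !(minn_idPl (ltnW _)) ?(maxn_idPr (ltnW _))//.
    by move: fN; case: (f _); case: (f _) => //= _; rewrite ?expr0 ?expr1; ring.
  by move=> e; move: hp; rewrite E e mulN1r oppr_gt0 => /(lt_trans hp'); rewrite ltxx.
have nc : ~~ crossing (x a, x b) (x a', x b').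
  by apply/negP => /(f_crossing ab ab' l l'); rewrite fE eqxx.
have {}E : height a b p.1 = height a' b' p.1.
  by rewrite E /page !(minn_idPl (ltnW _)) ?(maxn_idPr (ltnW _))// fE -expr2 sqrr_sign mul1r.
have lR : (x a)%:R < (x b)%:R :> R by rewrite ltr_nat.
have lR' : (x a')%:R < (x b')%:R :> R by rewrite ltr_nat.
have [k1 k2] := parabola_gt0 lR hp; have [k1' k2'] := parabola_gt0 lR' hp'.
have o1 : (x a < x b')%N by rewrite -(ltr_nat R); exact: lt_trans k2'.
have o2 : (x a' < x b)%N by rewrite -(ltr_nat R); exact: lt_trans k2.
have ne1 : (x a, x b) <> (x a', x b').
  by case=> /(x_inj va va') ea /(x_inj vb vb') eb; apply: ne; rewrite ea eb.
have [/andP[n1 n2]|nn] := boolP ((x a <= x a') && (x b' <= x b))%N.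
  by have := parabola_nested n1 n2 ne1 k1' k2'; rewrite -/(height a b p.1) E ltxx.
have [n1 n2] := overlap_nested o1 o2 nc nn.
by have := parabola_nested n1 n2 (nesym ne1) k1 k2; rewrite -/(height a b p.1) E ltxx.
Qed.

Lemma two_page_planar : planar R G.
Proof.
exists pt, arc; split.
- move=> a b va vb [] /eqP; rewrite eqr_nat => /eqP; exact: x_inj.
- by move=> a b ab; split; [exact: simple|exact: arcC].
- move=> a b c ab vc [_ /= /esym /eqP]; rewrite mulf_eq0 (negPf (page_neq0 _ _)) /=.
  have [va vb] := adj_vertices ab.
  by move=> /eqP /height0[] /x_inj h; [left|right]; apply: h.
- move=> a b a' b' ab ab'.
  wlog l : a b ab / (x a < x b)%N.
    move=> W; case: (ltngtP (x a) (x b)) => [|h|h]; first exact: W.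
      by rewrite arcC setUC; apply: W => //; exact: adj_sym.
    by have := adj_neq ab; rewrite h eqxx.
  wlog l' : a' b' ab' / (x a' < x b')%N.
    move=> W; case: (ltngtP (x a') (x b')) => [|h|h]; first exact: W.
      by rewrite (arcC a') (setUC [set a']); apply: W => //; exact: adj_sym.
    by have := adj_neq ab'; rewrite h eqxx.
  exact: meet_lt.
Qed.
End TwoPageDrawing.

Theorem theorem4 (R : realType) (n : nat) (hn : (3 <= n)%N)
    (P : set (plane R)) (s : 'I_n -> plane R * plane R)
    (hP : convex_polygon P s) :
  planar R (intersection_graph (range (fun i : 'I_n => side_disk (s i)))).
Proof.
have [convP [V [pos [pos_inj pos_lt HP HC]]]] := contact_positions hn hP.
have [f Hf] := two_pages convP HP.
have i0 : 'I_n := Ordinal (leq_trans (ltn0Sn 2) hn).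
set D := fun i : 'I_n => side_disk (s i).
(* Vertices of the graph are disks as sets, so each one is given a side producing it, without
   proving that this side is unique; [i0] is a dummy for sets that are no vertices. *)
have ex A : exists i, range D A -> D i = A.
  by have [[i _ <-]|nA] := pselect (range D A); [exists i|exists i0].
have [rep Hrep] := choice ex.
apply: (@two_page_planar R _ _ (fun A => pos (rep A)) f) => [A B /= vA vB /pos_inj E|].
  by rewrite -(Hrep A)// E Hrep.
have CC A B : adj (intersection_graph (range D)) A B -> (pos (rep A) < pos (rep B))%N ->
    chord (P : R * R -> Prop) n V (pos (rep A), pos (rep B)).
  move=> [vA vB AB I] l; split=> //=; apply: HC.
    by apply: contra_notN AB => /eqP E; rewrite -(Hrep A)// E Hrep.
  by rewrite -[side_disk _]/(D _) (Hrep A)// -[side_disk _]/(D _) (Hrep B).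
move=> A B A' B' AB AB' l l'; apply: Hf; exact: CC.
Qed.
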